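(* For each of the following eight triples $(Q',Q'',c)$, and every positive integer $n$ for which both formulae are defined, the quadrature formulae $Q'$ and $Q''$ are positive definite of order $4$, the quadrature formula $\widehat{Q}=(c+1)Q'-c\,Q''$ is negative definite of order $4$, and $c$ is the smallest positive number with this latter property (where the value of $c$ is given as a decimal, this means that such a smallest number $c$ exists, is independent of $n$, and equals the given decimal with error less than $10^{-6}$): 1'. $Q'=Q_{(3.3.1),2n}$, $Q''=Q_{(3.3.1),n}$, $c=1.104931$; 2'. $Q'=Q_{(3.3.2),2n}$, $Q''=Q_{(3.3.1),n}$, $c=\frac13$; 3'. $Q'=Q_{(3.3.2),2n}$, $Q''=Q_{(3.3.2),n}$, $c=1.803456$; 4'. $Q'=Q_{(3.3.2),2n}$, $Q''=Q_{(3.3.3),n}$, $c=1.088270$; 5'. $Q'=Q_{(3.3.2),2n}$, $Q''=Q_{(3.4.2),n}$, $c=1.207773$; 6'. $Q'=Q_{(3.3.3),2n}$, $Q''=Q_{(3.3.1),n}$, $c=\frac13$; 7'. $Q'=Q_{(3.3.3),2n}$, $Q''=Q_{(3.3.3),n}$, $c=1.601589$; 8'. $Q'=Q_{(3.3.3),2n}$, $Q''=Q_{(3.4.2),n}$, $c=1.828256$.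
   Context: A quadrature formula is a functional $Q[f]=\sum_{i=1}^{N}a_i f(\tau_i)$ with finitely many nodes $0\le\tau_1<\dots<\tau_N\le 1$ and real weights; its remainder is $R[Q;f]=\int_0^1 f(x)\,dx-Q[f]$. $Q$ is positive (respectively negative) definite of order $4$ if there is a constant $c_4(Q)>0$ (respectively $c_4(Q)<0$) such that for every $f\in C^4[0,1]$ there is $\xi\in[0,1]$ with $R[Q;f]=c_4(Q)f^{(4)}(\xi)$. Write $\sigma(x):=f(x)+f(1-x)$ and $y_{k,n}:=\frac{2k-1}{2n}$. The formulae are as follows (empty sums are $0$). $Q_{(3.3.1),n}[f]=-\frac5{12n}\sigma(0)+\frac3{2n}\sigma(\frac1{6n})-\frac3{4n}\sigma(\frac1{3n})+\frac1{6n}\sigma(\frac1{2n})+\frac1n\sum_{k=1}^{n-1}f(\frac kn)$, defined for $n\ge2$. $Q_{(3.3.2),n}[f]=-\frac1{12n}\sigma(0)+\frac8{9n}\sigma(\frac1{4n})-\frac1{3n}\sigma(\frac1{2n})+\frac{37}{36n}\sigma(\frac1n)+\frac1n\sum_{k=2}^{n-2}f(\frac kn)$, defined for $n\ge3$. $Q_{(3.3.3),n}[f]=-\frac1{9n}\sigma(0)+\frac1n\sigma(\frac1{4n})-\frac1{2n}\sigma(\frac1{2n})+\frac1{9n}\sigma(\frac3{4n})+\frac1n\sum_{k=1}^{n-1}f(\frac kn)$, defined for $n\ge2$. $Q_{(3.4.2),n}[f]=-\frac5{48n}\sigma(0)+\frac{15}{16n}\sigma(\frac1{6n})-\frac{21}{16n}\sigma(\frac1{3n})+\frac{71}{48n}\sigma(\frac1{2n})+\frac1n\sum_{k=2}^{n-1}f(y_{k,n})$,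 defined for $n\ge3$. $Q_{(\cdot),2n}$ denotes the corresponding formula with $n$ replaced by $2n$. *)

(* Defs.v *)
(* Classical reals of the standard library, with Coquelicot for integrals and
   finite sums. *)
From Stdlib Require Import Reals List Sorted.
From Coquelicot Require Import Coquelicot.
Open Scope R_scope.

Definition I01 (x : R) : Prop := 0 <= x <= 1.

(* [f] belongs to C^m[0,1] and [g] is its [m]-th derivative there.
   [D_in] and [continue_in] are relative to [I01], hence one-sided at the
   endpoints: nothing is required of [f] outside [0,1]. *)
Definition Cm_with_derivative (m : nat) (f g : R -> R) : Prop :=
  exists F : nat -> R -> R,
    F 0%nat = f /\ F m = g /\
    (forall k : nat, (k < m)%nat ->
       forall x : R, I01 x -> D_in (F k) (F (S k)) I01 x) /\
    (forall x : R, I01 x -> continue_in (F m) I01 x).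

Definition functional : Type := (R -> R) -> R.

(* The list consists of the pairs (node, weight). *)
Definition is_quadrature (Q : functional) : Prop :=
  exists s : list (R * R),
    Sorted Rlt (map fst s) /\
    List.Forall I01 (map fst s) /\
    forall f : R -> R,
      Q f = fold_right (fun p acc => snd p * f (fst p) + acc) 0 s.

Definition remainder (Q : functional) (f : R -> R) : R :=
  RInt f 0 1 - Q f.

Definition definite_with_constant (m : nat) (Q : functional) (c : R) : Prop :=
  forall f g : R -> R, Cm_with_derivative m f g ->
    exists xi : R, I01 xi /\ remainder Q f = c * g xi.

Definition positive_definite (m : nat) (Q : functional) : Prop :=
  is_quadrature Q /\ exists c : R, 0 < c /\ definite_with_constant m Q c.

Definition negative_definite (m : nat) (Q : functional) : Prop :=
  is_quadrature Q /\ exists c : R, c < 0 /\ definite_with_constant m Q c.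

(* [form n] is only meaningful for [n >= min_index]. *)
Record formula_family : Type := FormulaFamily {
  min_index : nat;
  form : nat -> functional
}.

Definition sigma (f : R -> R) (x : R) : R := f x + f (1 - x).

Definition ynode (k n : nat) : R := (2 * INR k - 1) / (2 * INR n).

(* [sum_n_m a p q] is [0] when [q < p]; the truncated subtractions in the upper
   bounds are exact for all admissible [n]. *)
Definition Q331 : formula_family := FormulaFamily 2 (fun n f =>
  let N := INR n in
    - (5 / (12 * N)) * sigma f 0
    + 3 / (2 * N) * sigma f (1 / (6 * N))
    - 3 / (4 * N) * sigma f (1 / (3 * N))
    + 1 / (6 * N) * sigma f (1 / (2 * N))
    + 1 / N * sum_n_m (fun k => f (INR k / N)) 1 (n - 1)).

Definition Q332 : formula_family := FormulaFamily 3 (fun n f =>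
  let N := INR n in
    - (1 / (12 * N)) * sigma f 0
    + 8 / (9 * N) * sigma f (1 / (4 * N))
    - 1 / (3 * N) * sigma f (1 / (2 * N))
    + 37 / (36 * N) * sigma f (1 / N)
    + 1 / N * sum_n_m (fun k => f (INR k / N)) 2 (n - 2)).

Definition Q333 : formula_family := FormulaFamily 2 (fun n f =>
  let N := INR n in
    - (1 / (9 * N)) * sigma f 0
    + 1 / N * sigma f (1 / (4 * N))
    - 1 / (2 * N) * sigma f (1 / (2 * N))
    + 1 / (9 * N) * sigma f (3 / (4 * N))
    + 1 / N * sum_n_m (fun k => f (INR k / N)) 1 (n - 1)).

Definition Q342 : formula_family := FormulaFamily 3 (fun n f =>
  let N := INR n in
    - (5 / (48 * N)) * sigma f 0
    + 15 / (16 * N) * sigma f (1 / (6 * N))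
    - 21 / (16 * N) * sigma f (1 / (3 * N))
    + 71 / (48 * N) * sigma f (1 / (2 * N))
    + 1 / N * sum_n_m (fun k => f (ynode k n)) 2 (n - 1)).

Definition Qhat (c : R) (Q' Q'' : functional) : functional :=
  fun f => (c + 1) * Q' f - c * Q'' f.

Definition smallest_factor (c : R) (Q' Q'' : functional) : Prop :=
  0 < c /\ negative_definite 4 (Qhat c Q' Q'') /\
  forall d : R, 0 < d -> negative_definite 4 (Qhat d Q' Q'') -> c <= d.

(* The same [c] has to serve all admissible [n]. *)
Definition triple_property (F' F'' : formula_family) (c : R) : Prop :=
  forall n : nat, (0 < n)%nat ->
    (min_index F' <= 2 * n)%nat -> (min_index F'' <= n)%nat ->
    positive_definite 4 (form F' (2 * n)) /\
    positive_definite 4 (form F'' n) /\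
    smallest_factor c (form F' (2 * n)) (form F'' n).

Definition triple_property_decimal
    (F' F'' : formula_family) (decimal : R) : Prop :=
  exists c : R, Rabs (c - decimal) < 1 / 10 ^ 6 /\ triple_property F' F'' c.

(* Main.v *)
Require Import Defs.
From Stdlib Require Import Reals List Sorted Lra Lia FunctionalExtensionality.
From Coquelicot Require Import Coquelicot.
Open Scope R_scope.

(** By Peano's theorem, a quadrature formula [Q] that is exact on cubics satisfies
    R[Q;f] = int_0^1 K(t) f^(4)(t) dt with K(t) = t^4/24 - Q[y |-> (t-y)_+^3]/6
    ([peano_representation]).  If [K] has one sign and is not identically zero,
    then [Q] is definite, by the mean value argument
    ([definite_of_signed_peano]); conversely, if [Q] is negative definite then
    [K <= 0], as the test function with fourth derivative max(0,K) shows
    ([peano_nonpos_of_negative_definite]).  Everything is thereby reduced to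
    kernels, and the kernel of [Qhat d Q' Q''] is (d+1) K' - d K''.

    Each of the four formulae is a compound trapezoidal or midpoint sum plus
    corrections near the two ends ([corrected_rule]), so with x = n t and up to the
    reflection t |-> 1-t the function k(x) = 24 n^4 K(x/n) does not depend on [n].
    Near the end it is an explicit piecewise quartic ([end_profile]); further
    inside it is u^2 (1-u)^2 in each cell, with [u] the position in the cell
    ([has_profile_corrected_rule]).  The latter, and exactness on cubics, follow
    from a single polynomial identity between the end weights and u^2 (1-u)^2
    ([admissible]), since 4 v^3 is the difference of the latter at v+1 and v.

    Passing from [n] to [2n] replaces k(x) by k(2x)/16.  So [Qhat d Q' Q''] is
    negative definite exactly when (d+1) k'(2x) <= 16 d k''(x) for x in [0,n/2].
    For x >= 1 this compares u^2 (1-u)^2 with its refinement and holds as soon as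
    d >= 1/3 ([cell_refine]), so only x in [0,1] matters ([scaled_ineq]), a
    condition free of [n] and closed in [d].  The smallest [d] therefore exists;
    it is enclosed from above by proving the inequality for a slightly larger
    rational [d], and from below by evaluating it at one point
    ([ex_smallest_factor]).  When c = 1/3, it is forced by the limit x -> 1
    ([third_le_of_scaled_ineq]).  The polynomial inequalities hold because on
    suitable subintervals all Bernstein coefficients are nonnegative. *)

(** * Weighted sums of point evaluations *)

(** The value at [f] of the functional with (node, weight) pairs [s]; the list need
    not be sorted and may repeat nodes. *)
Definition wsum (s : list (R * R)) (f : R -> R) : R :=
  fold_right (fun p acc => snd p * f (fst p) + acc) 0 s.

Lemma wsum_cons t w s f : wsum ((t, w) :: s) f = w * f t + wsum s f.
Proof. reflexivity. Qed.

Lemma wsum_ext s f g :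
  List.Forall I01 (map fst s) -> (forall x, I01 x -> f x = g x) ->
  wsum s f = wsum s g.
Proof.
  intros Hs Hfg; induction s as [|[t w] s IH]; simpl in *; [easy|].
  inversion Hs; subst. rewrite Hfg, IH; auto.
Qed.

Lemma wsum_linear s a b f g :
  wsum s (fun x => a * f x + b * g x) = a * wsum s f + b * wsum s g.
Proof.
  induction s as [|[t w] s IH]; [unfold wsum; simpl; ring|].
  rewrite !wsum_cons, IH; ring.
Qed.

Lemma wsum_scal s c f : wsum s (fun x => c * f x) = c * wsum s f.
Proof.
  induction s as [|[t w] s IH]; [unfold wsum; simpl; ring|].
  rewrite !wsum_cons, IH; ring.
Qed.

Lemma wsum_app s s' f : wsum (s ++ s') f = wsum s f + wsum s' f.
Proof.
  induction s as [|[t w] s IH]; [unfold wsum; simpl; ring|].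
  rewrite <- app_comm_cons, !wsum_cons, IH; ring.
Qed.

Lemma sorted_insert_node s t w :
  Sorted Rlt (map fst s) -> List.Forall I01 (map fst s) -> I01 t ->
  exists s',
    Sorted Rlt (map fst s') /\ List.Forall I01 (map fst s') /\
    (forall a, HdRel Rlt a (map fst s) -> a < t -> HdRel Rlt a (map fst s')) /\
    forall f, wsum s' f = w * f t + wsum s f.
Proof.
  induction s as [|[u v] s IH]; intros Hs HI Ht.
  - exists ((t, w) :: nil); simpl; repeat split; auto.
  - simpl in Hs, HI. inversion Hs as [|? ? Hs1 Hu]; subst.
    inversion HI as [|? ? Iu HI1]; subst.
    destruct (Rtotal_order t u) as [Htu|[Htu|Htu]].
    + exists ((t, w) :: (u, v) :: s); simpl; repeat split; auto.
    + subst u. exists ((t, w + v) :: s); simpl; repeat split; auto.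
      intros f; ring.
    + destruct (IH Hs1 HI1 Ht) as (s' & S1 & S2 & S3 & S4).
      exists ((u, v) :: s'); simpl; repeat split; auto.
      * intros a Ha _; inversion Ha; auto.
      * intros f. specialize (S4 f). unfold wsum in *; simpl; rewrite S4; ring.
Qed.

(** Sorting the nodes and merging repeated ones turns any weighted sum into a
    quadrature formula. *)
Lemma is_quadrature_wsum s Q :
  List.Forall I01 (map fst s) -> (forall f, Q f = wsum s f) -> is_quadrature Q.
Proof.
  intros Hs HQ.
  assert (H : exists s', Sorted Rlt (map fst s') /\ List.Forall I01 (map fst s') /\
    forall f, wsum s' f = wsum s f).
  { clear HQ; induction s as [|[t w] s IH].
    - exists nil; simpl; auto.
    - inversion Hs; subst. destruct IH as (s' & S1 & S2 & S3); auto.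
      destruct (sorted_insert_node s' t w S1 S2) as (s'' & T1 & T2 & _ & T4); auto.
      exists s''; repeat split; auto.
      intros f; rewrite T4, S3; reflexivity. }
  destruct H as (s' & S1 & S2 & S3).
  exists s'; repeat split; auto.
  intros f; rewrite HQ, <- S3; reflexivity.
Qed.

Lemma is_quadrature_point t : I01 t -> is_quadrature (fun f => f t).
Proof.
  intros Ht. apply (is_quadrature_wsum ((t, 1) :: nil)); simpl; auto.
  intros f; ring.
Qed.

Lemma is_quadrature_lincomb a b Q1 Q2 :
  is_quadrature Q1 -> is_quadrature Q2 ->
  is_quadrature (fun f => a * Q1 f + b * Q2 f).
Proof.
  intros (s1 & _ & H1 & E1) (s2 & _ & H2 & E2).
  set (sc := fun c => map (fun p : R * R => (fst p, c * snd p))).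
  assert (Hsc : forall c s, map fst (sc c s) = map fst s).
  { intros c s; unfold sc; rewrite map_map; reflexivity. }
  assert (Hw : forall c s f, wsum (sc c s) f = c * wsum s f).
  { intros c s f; induction s as [|[t w] s IH]; [unfold wsum; simpl; ring|].
    change (sc c ((t, w) :: s)) with ((t, c * w) :: sc c s).
    rewrite !wsum_cons, IH; ring. }
  apply (is_quadrature_wsum (sc a s1 ++ sc b s2)).
  - rewrite map_app, !Hsc. apply Forall_app; auto.
  - intros f. rewrite wsum_app, !Hw, E1, E2. reflexivity.
Qed.

Lemma is_quadrature_sum (x : nat -> R) p q :
  (forall k, (p <= k <= q)%nat -> I01 (x k)) ->
  is_quadrature (fun f => sum_n_m (fun k => f (x k)) p q).
Proof.
  induction q as [|q IH]; intros Hx.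
  - destruct p as [|p].
    + apply (is_quadrature_wsum ((x 0%nat, 1) :: nil)).
      * constructor; [apply Hx; lia|constructor].
      * intros f; rewrite sum_n_n; unfold wsum; simpl; ring.
    + apply (is_quadrature_wsum nil); [constructor|].
      intros f; rewrite sum_n_m_zero; [reflexivity|lia].
  - destruct (Compare_dec.le_lt_dec p (S q)) as [H|H].
    + destruct (is_quadrature_lincomb 1 1 (fun f => sum_n_m (fun k => f (x k)) p q)
        (fun f => f (x (S q)))) as (s & S1 & S2 & S3).
      * apply IH; intros; apply Hx; lia.
      * apply is_quadrature_point, Hx; lia.
      * exists s; repeat split; auto. intros f; rewrite <- S3.
        rewrite sum_n_Sm by lia. unfold plus; simpl; ring.
    + apply (is_quadrature_wsum nil); [constructor|].
      intros f; rewrite sum_n_m_zero; [reflexivity|lia].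
Qed.

(** * Extending a function of class C^4 from [0,1] to the line *)

(** The retraction of the line onto [0,1].  Composing with it makes a function that
    is continuous relative to [0,1] continuous everywhere. *)
Definition clamp (x : R) : R := Rmax 0 (Rmin 1 x).

Lemma clamp_I01 x : I01 (clamp x).
Proof. unfold clamp, I01, Rmax, Rmin; repeat destruct Rle_dec; lra. Qed.

Lemma clamp_id x : I01 x -> clamp x = x.
Proof. unfold clamp, I01, Rmax, Rmin; repeat destruct Rle_dec; lra. Qed.

Lemma clamp_dist x y : Rabs (clamp x - clamp y) <= Rabs (x - y).
Proof.
  unfold clamp, Rmax, Rmin; repeat destruct Rle_dec;
  unfold Rabs; repeat destruct Rcase_abs; lra.
Qed.

Lemma continuous_comp_clamp f x :
  (forall y, I01 y -> continue_in f I01 y) -> continuous (fun y => f (clamp y)) x.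
Proof.
  intros Hf. apply continuity_pt_filterlim. intros eps He.
  destruct (Hf (clamp x) (clamp_I01 x) eps He) as (d & Hd & H).
  exists d; split; auto. intros y [_ Hy]. simpl in *. unfold R_dist in *.
  destruct (Req_dec (clamp y) (clamp x)) as [E|E].
  - rewrite E, Rminus_diag_eq, Rabs_R0 by reflexivity; lra.
  - apply H. repeat split.
    + apply clamp_I01.
    + apply clamp_I01.
    + auto.
    + eapply Rle_lt_trans; [apply clamp_dist|exact Hy].
Qed.

Lemma is_derive_of_D_in f g x :
  0 < x < 1 -> D_in f g I01 x -> is_derive f x (g x).
Proof.
  intros Hx Hf. apply is_derive_Reals. intros eps He.
  destruct (Hf eps He) as (d & Hd & H).
  assert (Hm : 0 < Rmin d (Rmin x (1 - x))).
  { repeat apply Rmin_glb_lt; lra. }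
  exists (mkposreal _ Hm). intros h Hh0 Hh. simpl in Hh.
  apply Rmin_Rgt_l in Hh as [h1 Hh]. apply Rmin_Rgt_l in Hh as [h2 h3].
  simpl in H; unfold R_dist in H.
  specialize (H (x + h)). replace (x + h - x) with h in H by ring.
  apply H. repeat split; auto.
  - apply Rabs_def2 in h2. lra.
  - apply Rabs_def2 in h3. lra.
  - lra.
Qed.

(** If [g'] extends the one-sided derivative [g] of [f], then f(0) + int_0^x g' is
    an extension of [f] that is differentiable everywhere. *)
Lemma extend_antiderivative (f g g' : R -> R) :
  (forall x, I01 x -> D_in f g I01 x) ->
  (forall x, continuous g' x) ->
  (forall x, I01 x -> g' x = g x) ->
  exists f', (forall x, is_derive f' x (g' x)) /\ (forall x, I01 x -> f' x = f x).
Proof.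
  intros Hf Hc Hg.
  set (P := fun x => f 0 + RInt g' 0 x).
  assert (HP : forall x, is_derive P x (g' x)).
  { intros x. unfold P.
    evar_last. apply @is_derive_plus. apply is_derive_const.
    apply (is_derive_RInt g' (RInt g' 0) 0).
    - apply filter_forall. intros y.
      apply (@RInt_correct R_CompleteNormedModule), ex_RInt_continuous.
      intros; apply Hc.
    - apply Hc.
    - unfold plus, zero; simpl; ring. }
  exists P; split; auto.
  intros x Hx.
  (* [h] is continuous on [0,x] with zero derivative inside, hence constant *)
  set (h := fun y => P y - f (clamp y)).
  destruct (MVT_gen h 0 x (fun _ => 0)) as (c & _ & E).
  - rewrite Rmin_left, Rmax_right by apply Hx. intros y Hy.
    unfold I01 in Hx. unfold h.
    apply (is_derive_ext_loc (fun y => P y - f y)).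
    + assert (Hp : 0 < Rmin y (1 - y)) by (apply Rmin_glb_lt; lra).
      exists (mkposreal _ Hp). intros z Hz. simpl in Hz.
      apply Rmin_Rgt_l in Hz as [h2 h3].
      unfold abs, minus, plus, opp in *; simpl in *.
      apply Rabs_def2 in h2. apply Rabs_def2 in h3.
      rewrite clamp_id; auto. unfold I01; lra.
    + evar_last. apply @is_derive_minus. apply HP.
      apply (is_derive_of_D_in f g); [lra|]. apply Hf; unfold I01; lra.
      rewrite Hg by (unfold I01; lra). unfold minus, plus, opp; simpl; ring.
  - intros y _. apply continuity_pt_filterlim. unfold h.
    apply (continuous_minus P (fun y => f (clamp y)) y).
    + apply (@ex_derive_continuous R_AbsRing R_NormedModule); eexists; apply HP.
    + apply continuous_comp_clamp. intros; eapply cont_deriv, Hf; auto.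
  - unfold h in E. rewrite !clamp_id in E by (unfold I01 in *; lra).
    unfold P in E at 2. rewrite RInt_point in E.
    unfold zero in E; simpl in E. lra.
Qed.

(** Two-sided derivatives are thus available without loss: neither the remainder of
    a quadrature formula nor the definition of definiteness sees [f] outside [0,1]. *)
Lemma C4_extension f g :
  Cm_with_derivative 4 f g ->
  exists f0 f1 f2 f3 f4 : R -> R,
    (forall x, is_derive f0 x (f1 x)) /\ (forall x, is_derive f1 x (f2 x)) /\
    (forall x, is_derive f2 x (f3 x)) /\ (forall x, is_derive f3 x (f4 x)) /\
    (forall x, continuous f4 x) /\
    (forall x, I01 x -> f0 x = f x) /\ (forall x, I01 x -> f4 x = g x).
Proof.
  intros (F & E0 & E4 & HD & Hc). subst f g.
  assert (C4 : forall x, continuous (fun y => F 4%nat (clamp y)) x).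
  { intros x; apply continuous_comp_clamp; auto. }
  destruct (extend_antiderivative (F 3%nat) (F 4%nat) (fun y => F 4%nat (clamp y)))
    as (f3 & D3 & E3); auto.
  { intros x Hx; rewrite clamp_id; auto. }
  assert (Cd : forall a b : R -> R, (forall x, is_derive a x (b x)) ->
    forall x, continuous a x).
  { intros a b H x. apply (@ex_derive_continuous R_AbsRing R_NormedModule).
    eexists; apply H. }
  destruct (extend_antiderivative (F 2%nat) (F 3%nat) f3)
    as (f2 & D2 & E2); [intros; apply HD; auto|apply (Cd _ _ D3)|exact E3|].
  destruct (extend_antiderivative (F 1%nat) (F 2%nat) f2)
    as (f1 & D1 & E1); [intros; apply HD; auto|apply (Cd _ _ D2)|exact E2|].
  destruct (extend_antiderivative (F 0%nat) (F 1%nat) f1)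
    as (f0 & D0 & E0); [intros; apply HD; auto|apply (Cd _ _ D1)|exact E1|].
  exists f0, f1, f2, f3, (fun y => F 4%nat (clamp y)).
  repeat (split; [assumption|]). intros x Hx; rewrite clamp_id; auto.
Qed.

(** * The Peano kernel *)

(** The truncated cube x_+^3. *)
Definition cub (x : R) : R := Rmax 0 x ^ 3.

Lemma cub_nonneg x : 0 <= x -> cub x = x ^ 3.
Proof. intros H; unfold cub; rewrite Rmax_right; auto. Qed.

Lemma cub_nonpos x : x <= 0 -> cub x = 0.
Proof. intros H; unfold cub; rewrite Rmax_left; auto; ring. Qed.

Lemma continuous_pos_part (f : R -> R) x :
  continuous f x -> continuous (fun y => Rmax 0 (f y)) x.
Proof.
  intros Hf.
  apply (continuous_ext (fun y => (f y + Rabs (f y)) / 2)).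
  { intros y; unfold Rmax, Rabs; destruct Rle_dec, Rcase_abs; lra. }
  unfold Rdiv. apply (continuous_mult (fun y => f y + Rabs (f y)) (fun _ => / 2)).
  - apply (continuous_plus f (fun y => Rabs (f y))); auto.
    apply (continuous_comp f Rabs); auto. apply continuous_Rabs.
  - apply continuous_const.
Qed.

Lemma continuous_cub_shift y x : continuous (fun t => cub (t - y)) x.
Proof.
  assert (H : continuous (fun t => Rmax 0 (t - y)) x).
  { apply continuous_pos_part.
    apply (continuous_minus (fun t => t) (fun _ => y));
      [apply continuous_id|apply continuous_const]. }
  apply (continuous_comp (fun t => Rmax 0 (t - y)) (fun z => z ^ 3)); auto.
  apply (@ex_derive_continuous R_AbsRing R_NormedModule). auto_derive; auto.
Qed.

(** The Peano kernel of order 4 of the remainder of [Q]; the term t^4/24 is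
    int_0^1 (t-y)_+^3 dy / 6 for [t] in [0,1]. *)
Definition peano (Q : functional) (t : R) : R :=
  t ^ 4 / 24 - Q (fun y => cub (t - y)) / 6.

Lemma continuous_wsum_cub s x : continuous (fun t => wsum s (fun y => cub (t - y))) x.
Proof.
  induction s as [|[t w] s IH].
  - apply continuous_const.
  - apply (continuous_plus (fun u => w * cub (u - t))); [|exact IH].
    apply (continuous_mult (fun _ => w) (fun u => cub (u - t)));
      [apply continuous_const|apply continuous_cub_shift].
Qed.

Lemma continuous_peano Q x : is_quadrature Q -> continuous (peano Q) x.
Proof.
  intros (s & _ & _ & HQ).
  apply (continuous_ext (fun t => t ^ 4 / 24 - wsum s (fun y => cub (t - y)) * / 6)).
  { intros t; unfold peano; rewrite HQ; reflexivity. }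
  apply (continuous_minus (fun t => t ^ 4 / 24)
    (fun t => wsum s (fun y => cub (t - y)) * / 6)).
  - apply (@ex_derive_continuous R_AbsRing R_NormedModule). auto_derive; auto.
  - apply (continuous_mult (fun t => wsum s (fun y => cub (t - y))) (fun _ => / 6));
      [apply continuous_wsum_cub|apply continuous_const].
Qed.

Definition exact_on_cubics (Q : functional) : Prop :=
  forall a b c d,
    Q (fun x => a + b * x + c * x ^ 2 + d * x ^ 3) = a + b / 2 + c / 3 + d / 4.

Section Peano.

Variables f0 f1 f2 f3 f4 : R -> R.
Hypothesis D0 : forall x, is_derive f0 x (f1 x).
Hypothesis D1 : forall x, is_derive f1 x (f2 x).
Hypothesis D2 : forall x, is_derive f2 x (f3 x).
Hypothesis D3 : forall x, is_derive f3 x (f4 x).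
Hypothesis C4 : forall x, continuous f4 x.

Let DD0 x : Derive (fun t => f0 t) x = f1 x. Proof. apply is_derive_unique, D0. Qed.
Let DD1 x : Derive (fun t => f1 t) x = f2 x. Proof. apply is_derive_unique, D1. Qed.
Let DD2 x : Derive (fun t => f2 t) x = f3 x. Proof. apply is_derive_unique, D2. Qed.
Let DD3 x : Derive (fun t => f3 t) x = f4 x. Proof. apply is_derive_unique, D3. Qed.

(** The cubic Taylor polynomial of [f0] at 1. *)
Let taylor1 (y : R) : R :=
  f0 1 + f1 1 * (y - 1) + f2 1 / 2 * (y - 1) ^ 2 + f3 1 / 6 * (y - 1) ^ 3.

Lemma is_RInt_quartic_f4 :
  is_RInt (fun t => t ^ 4 / 24 * f4 t) 0 1
    (f3 1 / 24 - f2 1 / 6 + f1 1 / 2 - f0 1 + RInt f0 0 1).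
Proof.
  assert (C0 : forall x, continuous f0 x).
  { intros x; apply (@ex_derive_continuous R_AbsRing R_NormedModule).
    eexists; apply D0. }
  apply (is_RInt_ext (fun t => plus (t ^ 4 / 24 * f4 t - f0 t) (f0 t))).
  { intros; unfold plus; simpl; ring. }
  apply @is_RInt_plus.
  2: { apply (@RInt_correct R_CompleteNormedModule).
       apply (@ex_RInt_continuous R_CompleteNormedModule); auto. }
  (* [H] is an antiderivative of the first summand, by repeated partial integration *)
  set (H := fun t => t ^ 4 / 24 * f3 t - t ^ 3 / 6 * f2 t + t ^ 2 / 2 * f1 t
                     - t * f0 t).
  evar_last.
  - apply (is_RInt_derive H (fun t => t ^ 4 / 24 * f4 t - f0 t)).
    + intros x _. unfold H. auto_derive.
      * repeat split; eexists; eauto.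
      * rewrite DD0, DD1, DD2, DD3.
        field.
    + intros x _. apply (continuous_minus (fun t => t ^ 4 / 24 * f4 t)); auto.
      apply (continuous_mult (fun t => t ^ 4 / 24) f4); auto.
      apply (@ex_derive_continuous R_AbsRing R_NormedModule). auto_derive; auto.
  - unfold H, minus, plus, opp; simpl. field.
Qed.

(** Taylor's formula at 1 with integral remainder. *)
Lemma is_RInt_cub_f4 y : I01 y ->
  is_RInt (fun t => cub (t - y) / 6 * f4 t) 0 1 (f0 y - taylor1 y).
Proof.
  intros Hy.
  replace (f0 y - taylor1 y) with (plus 0 (f0 y - taylor1 y))
    by (unfold plus; simpl; ring).
  apply (@is_RInt_Chasles R_NormedModule _ 0 y 1).
  - apply (is_RInt_ext (fun _ => 0)).
    + unfold I01 in Hy. rewrite Rmin_left, Rmax_right by lra. intros x Hx.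
      rewrite cub_nonpos by lra. lra.
    + evar_last. apply @is_RInt_const. unfold scal; simpl; unfold mult; simpl; ring.
  - set (H := fun t => (t - y) ^ 3 / 6 * f3 t - (t - y) ^ 2 / 2 * f2 t
                       + (t - y) * f1 t - f0 t).
    apply (is_RInt_ext (fun t => (t - y) ^ 3 / 6 * f4 t)).
    { unfold I01 in Hy. rewrite Rmin_left, Rmax_right by lra. intros x Hx.
      rewrite cub_nonneg by lra. reflexivity. }
    evar_last.
    + apply (is_RInt_derive H (fun t => (t - y) ^ 3 / 6 * f4 t)).
      * intros x _. unfold H. auto_derive.
        -- repeat split; eexists; eauto.
        -- rewrite DD0, DD1, DD2, DD3.
           field.
      * intros x _.
        apply (continuous_mult (fun t => (t - y) ^ 3 / 6) f4); auto.
        apply (@ex_derive_continuous R_AbsRing R_NormedModule). auto_derive; auto.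
    + unfold H, taylor1, minus, plus, opp; simpl. field.
Qed.

Lemma is_RInt_wsum_cub_f4 s : List.Forall I01 (map fst s) ->
  is_RInt (fun t => wsum s (fun y => cub (t - y)) / 6 * f4 t) 0 1
    (wsum s f0 - wsum s taylor1).
Proof.
  induction s as [|[y w] s IH]; intros Hs.
  - apply (is_RInt_ext (fun _ => 0)).
    + intros x _. unfold wsum; simpl. lra.
    + evar_last. apply @is_RInt_const.
      unfold wsum, scal; simpl; unfold mult; simpl; ring.
  - inversion Hs as [|? ? Hy Hs']; subst.
    rewrite !wsum_cons.
    replace (w * f0 y + wsum s f0 - (w * taylor1 y + wsum s taylor1))
      with (plus (scal w (f0 y - taylor1 y)) (wsum s f0 - wsum s taylor1))
      by (unfold plus, scal; simpl; unfold mult; simpl; ring).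
    apply (is_RInt_ext (fun t => plus (scal w (cub (t - y) / 6 * f4 t))
      (wsum s (fun y => cub (t - y)) / 6 * f4 t))).
    { intros t _. rewrite wsum_cons. unfold plus, scal; simpl; unfold mult; simpl.
      field. }
    apply @is_RInt_plus; [apply @is_RInt_scal|]; auto.
    apply is_RInt_cub_f4; auto.
Qed.

(** Peano's theorem: the Taylor polynomial at 1 has remainder 0, and [Q] commutes
    with the integral of Taylor's remainder term. *)
Lemma peano_representation Q :
  is_quadrature Q -> exact_on_cubics Q ->
  is_RInt (fun t => peano Q t * f4 t) 0 1 (remainder Q f0).
Proof.
  intros (s & _ & Hs & HQ) Hex.
  change (forall f, Q f = wsum s f) in HQ.
  assert (HT : wsum s taylor1 = f0 1 - f1 1 / 2 + f2 1 / 6 - f3 1 / 24).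
  { rewrite <- HQ.
    transitivity (Q (fun x => (f0 1 - f1 1 + f2 1 / 2 - f3 1 / 6)
      + (f1 1 - f2 1 + f3 1 / 2) * x + (f2 1 / 2 - f3 1 / 2) * x ^ 2
      + f3 1 / 6 * x ^ 3)).
    - rewrite !HQ. apply wsum_ext; auto. intros x _. unfold taylor1. field.
    - rewrite Hex. field. }
  unfold remainder. rewrite HQ.
  evar_last.
  - apply (is_RInt_ext (fun t => minus (t ^ 4 / 24 * f4 t)
      (wsum s (fun y => cub (t - y)) / 6 * f4 t))).
    { intros t _. unfold peano. rewrite HQ.
      unfold minus, plus, opp; simpl. field. }
    apply @is_RInt_minus; [apply is_RInt_quartic_f4|apply is_RInt_wsum_cub_f4, Hs].
  - rewrite HT. unfold minus, plus, opp; simpl. field.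
Qed.

End Peano.

(** * Definiteness and the sign of the Peano kernel *)

Lemma ex_RInt_of_continuous (h : R -> R) a b :
  (forall x, continuous h x) -> ex_RInt h a b.
Proof. intros H. apply (@ex_RInt_continuous R_CompleteNormedModule); auto. Qed.

Lemma RInt_pos_of_pos_at (h : R -> R) t0 :
  (forall x, continuous h x) -> (forall x, I01 x -> 0 <= h x) ->
  0 < t0 < 1 -> 0 < h t0 -> 0 < RInt h 0 1.
Proof.
  intros Hc Hp Ht H0.
  destruct (proj1 (filterlim_locally h (h t0)) (Hc t0) (mkposreal _ H0)) as (d & Hd).
  set (r := Rmin (d / 2) (Rmin (t0 / 2) ((1 - t0) / 2))).
  assert (Hr : 0 < r).
  { unfold r. destruct d as [d Hd']; simpl. repeat apply Rmin_glb_lt; lra. }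
  assert (r1 : r <= d / 2) by apply Rmin_l.
  assert (r2 : r <= t0 / 2) by (eapply Rle_trans; [apply Rmin_r|apply Rmin_l]).
  assert (r3 : r <= (1 - t0) / 2) by (eapply Rle_trans; [apply Rmin_r|apply Rmin_r]).
  assert (H1 : 0 < RInt h (t0 - r) (t0 + r)).
  { apply RInt_gt_0; [lra| |intros; apply Hc].
    intros x Hx. specialize (Hd x).
    unfold ball in Hd; simpl in Hd; unfold AbsRing_ball, abs, minus, plus, opp in Hd;
      simpl in Hd.
    assert (A : Rabs (h x + - h t0) < h t0).
    { apply Hd. apply Rabs_def1; lra. }
    apply Rabs_def2 in A. lra. }
  assert (H2 : 0 <= RInt h 0 (t0 - r)).
  { apply RInt_ge_0; [lra|apply ex_RInt_of_continuous, Hc|].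
    intros; apply Hp; unfold I01; lra. }
  assert (H3 : 0 <= RInt h (t0 + r) 1).
  { apply RInt_ge_0; [lra|apply ex_RInt_of_continuous, Hc|].
    intros; apply Hp; unfold I01; lra. }
  rewrite <- (RInt_Chasles h 0 (t0 - r) 1) by apply ex_RInt_of_continuous, Hc.
  rewrite <- (RInt_Chasles h (t0 - r) (t0 + r) 1) by apply ex_RInt_of_continuous, Hc.
  unfold plus; simpl. lra.
Qed.

Lemma remainder_ext Q f g :
  is_quadrature Q -> (forall x, I01 x -> f x = g x) -> remainder Q f = remainder Q g.
Proof.
  intros (s & _ & Hs & HQ) H. unfold remainder. rewrite !HQ. apply (f_equal2 Rminus).
  - apply RInt_ext. rewrite Rmin_left, Rmax_right by lra.
    intros x Hx; apply H; unfold I01; lra.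
  - apply (wsum_ext s f g); auto.
Qed.

(** The factor [e] lets one proof serve both signs: it is used with e = 1 and
    e = -1.  The constant is c = int_0^1 K. *)
Lemma definite_of_signed_peano Q e t0 :
  is_quadrature Q -> exact_on_cubics Q ->
  (forall t, I01 t -> 0 <= e * peano Q t) ->
  0 < t0 < 1 -> 0 < e * peano Q t0 ->
  exists c, 0 < e * c /\ definite_with_constant 4 Q c.
Proof.
  intros HQ Hex Hsign Ht0 Hpos.
  assert (CK : forall x, continuous (peano Q) x).
  { intros; apply continuous_peano; auto. }
  assert (CeK : forall x, continuous (fun t => e * peano Q t) x).
  { intros x; apply (continuous_mult (fun _ => e) (peano Q)); auto.
    apply continuous_const. }
  set (c := RInt (peano Q) 0 1).
  assert (Ec : RInt (fun t => e * peano Q t) 0 1 = e * c).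
  { apply (RInt_scal (peano Q)). apply ex_RInt_of_continuous; auto. }
  assert (Hc : 0 < e * c).
  { rewrite <- Ec. apply (RInt_pos_of_pos_at _ t0); auto. }
  exists c; split; auto.
  intros f g Hfg.
  destruct (C4_extension f g Hfg)
    as (f0 & f1 & f2 & f3 & f4 & D0 & D1 & D2 & D3 & C4 & E0 & E4).
  rewrite (remainder_ext Q f f0) by (auto; intros; symmetry; auto).
  assert (HR := is_RInt_unique _ _ _ _
    (peano_representation f0 f1 f2 f3 f4 D0 D1 D2 D3 C4 Q HQ Hex)).
  assert (C4' : continuity f4).
  { intros x. apply continuity_pt_filterlim, C4. }
  destruct (continuity_ab_maj f4 0 1) as (xM & HM & IM); [lra|intros; apply C4'|].
  destruct (continuity_ab_min f4 0 1) as (xm & Hm & Im); [lra|intros; apply C4'|].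
  assert (CKf : forall x, continuous (fun t => e * peano Q t * f4 t) x).
  { intros x; apply (continuous_mult (fun t => e * peano Q t) f4); auto. }
  assert (ER : RInt (fun t => e * peano Q t * f4 t) 0 1 = e * remainder Q f0).
  { rewrite <- HR.
    transitivity (RInt (fun t => scal e (peano Q t * f4 t)) 0 1).
    - apply RInt_ext. intros; unfold scal; simpl; unfold mult; simpl; ring.
    - apply (RInt_scal (fun t => peano Q t * f4 t)).
      apply ex_RInt_of_continuous. intros x.
      apply (continuous_mult (peano Q) f4); auto. }
  assert (bound : forall m, RInt (fun t => m * (e * peano Q t)) 0 1 = m * (e * c)).
  { intros m. rewrite <- Ec. apply (RInt_scal (fun t => e * peano Q t)).
    apply ex_RInt_of_continuous; auto. }
  assert (Cb : forall m x, continuous (fun t => m * (e * peano Q t)) x).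
  { intros m x; apply (continuous_mult (fun _ => m) (fun t => e * peano Q t)); auto.
    apply continuous_const. }
  assert (Hlo : f4 xm * (e * c) <= e * remainder Q f0).
  { rewrite <- bound, <- ER. apply RInt_le; [lra| | |].
    1, 2: apply ex_RInt_of_continuous; auto.
    intros x Hx. rewrite (Rmult_comm (f4 xm)). apply Rmult_le_compat_l.
    - apply Hsign; unfold I01; lra.
    - apply Hm; lra. }
  assert (Hhi : e * remainder Q f0 <= f4 xM * (e * c)).
  { rewrite <- bound, <- ER. apply RInt_le; [lra| | |].
    1, 2: apply ex_RInt_of_continuous; auto.
    intros x Hx. rewrite (Rmult_comm (f4 xM)). apply Rmult_le_compat_l.
    - apply Hsign; unfold I01; lra.
    - apply HM; lra. }
  assert (Hc0 : c <> 0) by (intros E; rewrite E in Hc; lra).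
  assert (He0 : e <> 0) by (intros E; rewrite E in Hc; lra).
  (* the weighted mean [v] of [f4] lies between its minimum and its maximum *)
  set (v := remainder Q f0 / c).
  assert (Ev : e * remainder Q f0 = v * (e * c)) by (unfold v; field; auto).
  rewrite Ev in Hlo, Hhi.
  apply Rmult_le_reg_r in Hlo; auto. apply Rmult_le_reg_r in Hhi; auto.
  destruct (IVT_gen f4 xm xM v C4') as (xi & Hxi & Exi).
  { split.
    - eapply Rle_trans; [apply Rmin_l|exact Hlo].
    - eapply Rle_trans; [exact Hhi|apply Rmax_r]. }
  exists xi.
  assert (Ixi : I01 xi).
  { revert Hxi; unfold I01, Rmin, Rmax; repeat destruct Rle_dec; lra. }
  split; auto. rewrite <- E4, Exi by auto. unfold v; field; auto.
Qed.

Lemma D_in_of_is_derive (f g : R -> R) x : is_derive f x (g x) -> D_in f g I01 x.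
Proof.
  intros H. apply is_derive_Reals in H. apply derivable_pt_lim_D_in in H.
  intros eps He. destruct (H eps He) as (d & Hd & Hlim).
  exists d; split; auto. intros y [[Hy Hn] Hyd]. apply Hlim.
  repeat split; auto.
Qed.

Lemma continue_in_of_continuous (f : R -> R) x : continuous f x -> continue_in f I01 x.
Proof.
  intros H. apply continuity_pt_filterlim in H.
  intros eps He. destruct (H eps He) as (d & Hd & Hlim).
  exists d; split; auto. intros y [[Hy Hn] Hyd]. apply Hlim.
  repeat split; auto.
Qed.

Lemma ex_antiderivative (g : R -> R) :
  (forall x, continuous g x) -> exists f, forall x, is_derive f x (g x).
Proof.
  intros Hc. exists (RInt g 0). intros x.
  apply (is_derive_RInt g (RInt g 0) 0); auto.
  apply filter_forall. intros y.
  apply (@RInt_correct R_CompleteNormedModule), ex_RInt_of_continuous, Hc.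
Qed.

Lemma peano_0 Q : is_quadrature Q -> peano Q 0 = 0.
Proof.
  intros (s & _ & Hs & HQ). change (forall f, Q f = wsum s f) in HQ.
  unfold peano. rewrite HQ, (wsum_ext s _ (fun _ => 0 * 0)); auto.
  - rewrite wsum_scal. field.
  - intros y Hy. unfold I01 in Hy. rewrite cub_nonpos by lra. ring.
Qed.

(** If K(t) > 0 for some [t], the function with fourth derivative max(0,K) has
    remainder int K max(0,K) > 0, which a negative constant excludes. *)
Lemma peano_nonpos_of_negative_definite Q :
  exact_on_cubics Q -> negative_definite 4 Q ->
  forall t, 0 <= t < 1 -> peano Q t <= 0.
Proof.
  intros Hex (HQ & c & Hc & Hdef) t Ht0.
  destruct (Req_dec t 0) as [->|Hne]; [rewrite peano_0; auto; lra|].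
  assert (Ht : 0 < t < 1) by lra. clear Ht0 Hne.
  destruct (Rle_lt_dec (peano Q t) 0) as [|Hpos]; auto. exfalso.
  assert (CK : forall x, continuous (peano Q) x).
  { intros; apply continuous_peano; auto. }
  set (f4 := fun x => Rmax 0 (peano Q x)).
  assert (C4 : forall x, continuous f4 x).
  { intros; apply continuous_pos_part, CK. }
  assert (Cd : forall a b : R -> R, (forall x, is_derive a x (b x)) ->
    forall x, continuous a x).
  { intros a b H x. apply (@ex_derive_continuous R_AbsRing R_NormedModule).
    eexists; apply H. }
  destruct (ex_antiderivative f4 C4) as (f3 & D3).
  destruct (ex_antiderivative f3 (Cd _ _ D3)) as (f2 & D2).
  destruct (ex_antiderivative f2 (Cd _ _ D2)) as (f1 & D1).
  destruct (ex_antiderivative f1 (Cd _ _ D1)) as (f0 & D0).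
  destruct (Hdef f0 f4) as (xi & _ & Exi).
  { exists (fun k => match k with
      | 0%nat => f0 | 1%nat => f1 | 2%nat => f2 | 3%nat => f3 | _ => f4 end).
    repeat split.
    - intros k Hk x _.
      destruct k as [|[|[|[|k]]]]; try (apply D_in_of_is_derive; auto).
      lia.
    - intros x _. apply continue_in_of_continuous, C4. }
  rewrite <- (is_RInt_unique _ _ _ _
    (peano_representation f0 f1 f2 f3 f4 D0 D1 D2 D3 C4 Q HQ Hex)) in Exi.
  assert (P : 0 < RInt (fun x => peano Q x * f4 x) 0 1).
  { apply (RInt_pos_of_pos_at _ t); auto.
    - intros x; apply (continuous_mult (peano Q) f4); auto.
    - intros x _. unfold f4, Rmax. destruct Rle_dec; nra.
    - unfold f4. rewrite Rmax_right by lra. nra. }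
  assert (N : 0 <= f4 xi) by apply Rmax_l.
  nra.
Qed.

(** * Compound rules with end corrections *)

(** The kernel of a compound rule inside one cell, normalised by the factor
    24 n^4; [x] in [0,1] is the position in the cell. *)
Definition cell (x : R) : R := x ^ 2 * (1 - x) ^ 2.

(** The compound sum (1/n) sum_(k=1..M) f((k-s)/n), plus end corrections: a pair
    (y,w) of [l] contributes w/n at the two points at distance y/n from the ends.
    The shift is s = 0, M = n-1 for the trapezoidal type and s = 1/2, M = n for the
    midpoint type. *)
Definition corrected_rule (l : list (R * R)) (s : R) (M n : nat) : functional :=
  fun f => 1 / INR n *
    (wsum l (fun y => Defs.sigma f (y / INR n)) +
     sum_n_m (fun k => f ((INR k - s) / INR n)) 1 M).

(** M + 1 = n + 2s says that the nodes (k-s)/n are symmetric about 1/2.  The last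
    clause collects the moment conditions on the end corrections: beyond all of
    them, the kernel continues like u^2 (1-u)^2. *)
Definition admissible (l : list (R * R)) (s : R) (M n : nat) : Prop :=
  (2 <= n)%nat /\ INR M + 1 = INR n + 2 * s /\ (s = 0 \/ s = 1 / 2) /\
  List.Forall (fun p => 0 <= fst p <= 1 - s) l /\
  forall z, z ^ 4 - 4 * wsum l (fun y => (z - y) ^ 3) = cell (z + s).

(** The normalised kernel as a function of x = n t for x <= 2 - s: only the end
    corrections and the first node 1 - s of the compound sum have been passed. *)
Definition end_profile (l : list (R * R)) (s x : R) : R :=
  x ^ 4 - 4 * wsum l (fun y => cub (x - y)) - 4 * cub (x - (1 - s)).

(** What the definiteness argument needs to know about the kernel of [Q] at scale
    1/n.  By symmetry only t <= 1/2 is described: by [k] near the end, and by [cell]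
    in the cell from m - s to m + 1 - s, for m >= 1. *)
Record has_profile (Q : functional) (n : nat) (s : R) (k : R -> R) : Prop := {
  profile_quadrature : is_quadrature Q;
  profile_exact : exact_on_cubics Q;
  profile_symmetric : forall t, peano Q (1 - t) = peano Q t;
  profile_end : forall x, 0 <= x <= INR n / 2 -> x <= 2 - s ->
    24 * INR n ^ 4 * peano Q (x / INR n) = k x;
  profile_cell : forall m u, (1 <= m)%nat -> 0 <= u <= 1 ->
    INR m + u - s <= INR n / 2 ->
    24 * INR n ^ 4 * peano Q ((INR m + u - s) / INR n) = cell u
}.

Lemma wsum_Forall_ext (P : R -> Prop) s f g :
  List.Forall (fun p => P (fst p)) s -> (forall x, P x -> f x = g x) ->
  wsum s f = wsum s g.
Proof.
  intros Hs Hfg; induction s as [|[t w] s IH]; [easy|].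
  inversion Hs; subst. rewrite !wsum_cons, Hfg, IH; auto.
Qed.

Lemma quadrature_linear Q a b f g :
  is_quadrature Q -> Q (fun x => a * f x + b * g x) = a * Q f + b * Q g.
Proof.
  intros (s & _ & _ & HQ). change (forall f, Q f = wsum s f) in HQ.
  rewrite !HQ. apply wsum_linear.
Qed.

Lemma sum_rev (a : nat -> R) M :
  sum_n_m (fun k => a (M + 1 - k)%nat) 1 M = sum_n_m a 1 M.
Proof.
  induction M as [|M IH].
  - rewrite !sum_n_m_zero by lia. reflexivity.
  - rewrite sum_Sn_m, (sum_n_Sm a 1 M) by lia.
    rewrite <- sum_n_m_S.
    replace (S M + 1 - 1)%nat with (S M) by lia.
    rewrite <- IH. unfold plus; simpl. rewrite Rplus_comm. f_equal.
Qed.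

Lemma sum_Rmult_l c (a : nat -> R) p q :
  sum_n_m (fun k => c * a k) p q = c * sum_n_m a p q.
Proof. exact (sum_n_m_mult_l (K := R_Ring) c a p q). Qed.

Lemma sum_ext_loc (a b : nat -> R) p q :
  (forall k, (p <= k <= q)%nat -> a k = b k) -> sum_n_m a p q = sum_n_m b p q.
Proof. apply sum_n_m_ext_loc. Qed.

Lemma sum_ext (a b : nat -> R) p q :
  (forall k, a k = b k) -> sum_n_m a p q = sum_n_m b p q.
Proof. intros H; apply sum_ext_loc; auto. Qed.

Lemma cell_succ v : cell (v + 1) = cell v + 4 * v ^ 3.
Proof. unfold cell; ring. Qed.

Lemma cell_compl v : cell (1 - v) = cell v.
Proof. unfold cell; ring. Qed.

(** The sum telescopes by [cell_succ]. *)
Lemma sum_cubes v M :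
  4 * sum_n_m (fun k => (v - INR k) ^ 3) 1 M = cell v - cell (v - INR M).
Proof.
  induction M as [|M IH].
  - rewrite sum_n_m_zero by lia. unfold zero; simpl. rewrite Rminus_0_r; ring.
  - rewrite sum_n_Sm by lia. unfold plus; simpl plus.
    change (4 * (sum_n_m (fun k => (v - INR k) ^ 3) 1 M + (v - INR (S M)) ^ 3)
      = cell v - cell (v - INR (S M))).
    rewrite Rmult_plus_distr_l, IH.
    replace (v - INR M) with (v - INR (S M) + 1) by (rewrite S_INR; ring).
    rewrite cell_succ. ring.
Qed.

Lemma cub_scale N a : 0 < N -> cub (a / N) = cub a / N ^ 3.
Proof.
  intros HN. destruct (Rle_dec 0 a) as [H|H].
  - rewrite !cub_nonneg; auto; [field; lra|].
    apply Rmult_le_pos; auto. left; apply Rinv_0_lt_compat; auto.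
  - rewrite !cub_nonpos; [field| |]; try lra.
    assert (0 < - a / N) by (apply Rdiv_lt_0_compat; lra).
    unfold Rdiv in *; lra.
Qed.

Section CorrectedRule.

Variables (l : list (R * R)) (s : R) (M n : nat).
Hypothesis adm : admissible l s M n.

Let N := INR n.
Let Q := corrected_rule l s M n.

Lemma adm_N : 2 <= N.
Proof. destruct adm as (H & _). apply le_INR in H. exact H. Qed.

Lemma scaled_node_I01 y : 0 <= y <= N -> I01 (y / N).
Proof.
  assert (HN := adm_N). intros H. split.
  - apply Rmult_le_pos; [lra|]. left; apply Rinv_0_lt_compat; lra.
  - apply Rmult_le_reg_r with N; [lra|]. unfold Rdiv.
    rewrite Rmult_assoc, Rinv_l by lra. lra.
Qed.

Lemma adm_s : 0 <= s <= 1 / 2.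
Proof. destruct adm as (_ & _ & [H|H] & _); lra. Qed.

Lemma adm_M k : (1 <= k <= M)%nat -> 0 <= INR k - s <= N.
Proof.
  intros [H1 H2]. destruct adm as (_ & E & _). assert (Hs := adm_s).
  apply le_INR in H1. apply le_INR in H2. simpl in H1. unfold N. lra.
Qed.

Lemma is_quadrature_corrected_rule : is_quadrature Q.
Proof.
  assert (HN := adm_N). assert (Hs := adm_s).
  destruct adm as (_ & _ & _ & Hl & _).
  assert (H1 : is_quadrature (fun f => wsum l (fun y => Defs.sigma f (y / N)))).
  { clear - Hl Hs adm HN. revert Hl. generalize l as l'.
    induction l' as [|[t w] l' IH]; intros Hl.
    - apply (is_quadrature_wsum nil); [constructor|reflexivity].
    - inversion Hl as [|? ? Ht Hl']; subst; cbn [fst] in Ht.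
      assert (I : I01 (t / N)) by (apply scaled_node_I01; lra).
      assert (J : I01 (1 - t / N)) by (unfold I01 in *; lra).
      assert (H := is_quadrature_lincomb w 1 _ _ (is_quadrature_lincomb 1 1 _ _
        (is_quadrature_point _ I) (is_quadrature_point _ J)) (IH Hl')).
      destruct H as (q & q1 & q2 & q3). exists q; repeat split; auto.
      intros f; rewrite <- q3. rewrite wsum_cons. unfold Defs.sigma; ring. }
  assert (H2 : is_quadrature (fun f => sum_n_m (fun k => f ((INR k - s) / N)) 1 M)).
  { apply is_quadrature_sum. intros k Hk. apply scaled_node_I01, adm_M, Hk. }
  assert (H := is_quadrature_lincomb (1 / N) (1 / N) _ _ H1 H2).
  destruct H as (q & q1 & q2 & q3). exists q; repeat split; auto.
  intros f; rewrite <- q3. unfold Q, corrected_rule; fold N; ring.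
Qed.

Lemma corrected_rule_reflect f : Q (fun x => f (1 - x)) = Q f.
Proof.
  assert (HN := adm_N). destruct adm as (_ & E & _).
  unfold Q, corrected_rule; fold N. fold N in E. f_equal. f_equal.
  - apply (wsum_Forall_ext (fun _ => True)).
    + apply Forall_forall; auto.
    + intros y _. unfold Defs.sigma. rewrite Rplus_comm. f_equal. f_equal; ring.
  - rewrite <- sum_rev. apply sum_ext_loc. intros k Hk. f_equal.
    rewrite minus_INR, plus_INR by lia. simpl. rewrite E. field. lra.
Qed.

(** On (z-y)^3 the values of [cell] contributed by the two ends and by the compound
    sum cancel, leaving the two fourth powers that make up the exact integral.
    Four values of [z] then determine the moments of orders 0 to 3. *)
Lemma exact_corrected_rule : exact_on_cubics Q.
Proof.
  assert (HN := adm_N).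
  assert (HQ := is_quadrature_corrected_rule).
  assert (cubes : forall z, Q (fun y => (z - y) ^ 3) = (z ^ 4 - (1 - z) ^ 4) / 4).
  { intros z. destruct adm as (_ & E & _ & _ & Hm). fold N in E.
    unfold Q, corrected_rule; fold N.
    assert (W : wsum l (fun y => Defs.sigma (fun x => (z - x) ^ 3) (y / N)) =
      / N ^ 3 * wsum l (fun y => (z * N - y) ^ 3)
      - / N ^ 3 * wsum l (fun y => ((1 - z) * N - y) ^ 3)).
    { transitivity (/ N ^ 3 * wsum l (fun y => (z * N - y) ^ 3)
        + (- / N ^ 3) * wsum l (fun y => ((1 - z) * N - y) ^ 3)); [|ring].
      rewrite <- wsum_linear.
      apply (wsum_Forall_ext (fun _ => True)).
      - apply Forall_forall; auto.
      - intros y _. unfold Defs.sigma. field. lra. }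
    assert (S : 4 * sum_n_m (fun k => (z - (INR k - s) / N) ^ 3) 1 M =
      / N ^ 3 * (cell (z * N + s) - cell (z * N + s - INR M))).
    { rewrite <- sum_cubes.
      rewrite (sum_ext _ (fun k => / N ^ 3 * ((z * N + s - INR k) ^ 3))).
      - rewrite sum_Rmult_l. ring.
      - intros k. field. lra. }
    assert (M1 := Hm (z * N)). assert (M2 := Hm ((1 - z) * N)).
    rewrite <- (cell_compl ((1 - z) * N + s)) in M2.
    replace (1 - ((1 - z) * N + s)) with (z * N + s - INR M) in M2.
    2: { replace (INR M) with (N + 2 * s - 1) by lra. ring. }
    rewrite W.
    replace (sum_n_m (fun k => (z - (INR k - s) / N) ^ 3) 1 M) with
      (/ N ^ 3 * (cell (z * N + s) - cell (z * N + s - INR M)) / 4) by lra.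
    rewrite <- M1, <- M2. field. lra. }
  intros a b c d.
  assert (L : forall z, Q (fun y => (z - y) ^ 3) =
    z ^ 3 * Q (fun _ => 1) - 3 * z ^ 2 * Q (fun y => y)
    + 3 * z * Q (fun y => y ^ 2) - Q (fun y => y ^ 3)).
  { intros z.
    transitivity (Q (fun y => 1 * (z ^ 3 * 1 + (- 3 * z ^ 2) * y)
      + 1 * (3 * z * y ^ 2 + (-1) * y ^ 3))).
    - f_equal. apply functional_extensionality; intros y; ring.
    - rewrite (quadrature_linear Q 1 1 (fun y => z ^ 3 * 1 + (- 3 * z ^ 2) * y)
        (fun y => 3 * z * y ^ 2 + (-1) * y ^ 3)) by exact HQ.
      rewrite (quadrature_linear Q (z ^ 3) _ (fun _ => 1) (fun y => y)) by exact HQ.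
      rewrite (quadrature_linear Q (3 * z) (-1) (fun y => y ^ 2) (fun y => y ^ 3))
        by exact HQ.
      ring. }
  transitivity (Q (fun y => 1 * (a * 1 + b * y) + 1 * (c * y ^ 2 + d * y ^ 3))).
  { f_equal. apply functional_extensionality; intros y; ring. }
  rewrite (quadrature_linear Q 1 1 (fun y => a * 1 + b * y)
    (fun y => c * y ^ 2 + d * y ^ 3)) by exact HQ.
  rewrite (quadrature_linear Q a b (fun _ => 1) (fun y => y)) by exact HQ.
  rewrite (quadrature_linear Q c d (fun y => y ^ 2) (fun y => y ^ 3)) by exact HQ.
  assert (z0 := cubes 0). assert (z1 := cubes 1).
  assert (z2 := cubes (-1)). assert (z3 := cubes 2).
  rewrite L in z0, z1, z2, z3.
  assert (m0 : Q (fun _ => 1) = 1) by lra.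
  assert (m1 : Q (fun y => y) = 1 / 2) by lra.
  assert (m2 : Q (fun y => y ^ 2) = 1 / 3) by lra.
  assert (m3 : Q (fun y => y ^ 3) = 1 / 4) by lra.
  rewrite m0, m1, m2, m3. field.
Qed.

Lemma peano_symmetric t : peano Q (1 - t) = peano Q t.
Proof.
  unfold peano.
  rewrite <- (corrected_rule_reflect (fun y => cub (1 - t - y))).
  assert (E : Q (fun x => cub (1 - t - (1 - x))) =
    Q (fun y => cub (t - y)) - (t ^ 3 - 3 * t ^ 2 / 2 + t - 1 / 4)).
  { transitivity (Q (fun y => 1 * cub (t - y) + (-1) *
      (t ^ 3 + (- 3 * t ^ 2) * y + 3 * t * y ^ 2 + (-1) * y ^ 3))).
    - f_equal. apply functional_extensionality; intros y.
      destruct (Rle_dec t y).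
      + rewrite cub_nonneg, cub_nonpos by lra. ring.
      + rewrite cub_nonpos, cub_nonneg by lra. ring.
    - rewrite (quadrature_linear Q 1 (-1) (fun y => cub (t - y))
        (fun y => t ^ 3 + (- 3 * t ^ 2) * y + 3 * t * y ^ 2 + (-1) * y ^ 3))
        by exact is_quadrature_corrected_rule.
      rewrite exact_corrected_rule. field. }
  rewrite E. field.
Qed.

(** The corrections at the right end do not contribute for t <= 1/2, since n >= 2
    and their distances to 1 are at most 1/n. *)
Lemma peano_scaled x : 0 <= x <= N / 2 ->
  24 * N ^ 4 * peano Q (x / N) =
  x ^ 4 - 4 * wsum l (fun y => cub (x - y))
  - 4 * sum_n_m (fun k => cub (x - (INR k - s))) 1 M.
Proof.
  intros Hx. assert (HN := adm_N). assert (Hs := adm_s).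
  destruct adm as (_ & _ & _ & Hl & _).
  unfold peano, Q, corrected_rule; fold N.
  rewrite (wsum_Forall_ext (fun y => 0 <= y <= 1 - s) l
    (fun y => Defs.sigma (fun v => cub (x / N - v)) (y / N))
    (fun y => / N ^ 3 * cub (x - y))); auto.
  2: { intros y Hy. unfold Defs.sigma.
       replace (x / N - y / N) with ((x - y) / N) by (field; lra).
       replace (x / N - (1 - y / N)) with ((x + y - N) / N) by (field; lra).
       rewrite !cub_scale by lra.
       rewrite (cub_nonpos (x + y - N)) by lra. field; lra. }
  rewrite wsum_scal.
  rewrite (sum_ext (fun k => cub (x / N - (INR k - s) / N))
    (fun k => / N ^ 3 * (cub (x - (INR k - s))))).
  2: { intros k.
       replace (x / N - (INR k - s) / N) with ((x - (INR k - s)) / N) by (field; lra).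
       rewrite cub_scale by lra. field; lra. }
  rewrite sum_Rmult_l. field. lra.
Qed.

Lemma sum_cub_cut m u : (m <= M)%nat -> 0 <= u <= 1 ->
  sum_n_m (fun k => cub (INR m + u - INR k)) 1 M =
  sum_n_m (fun k => (INR m + u - INR k) ^ 3) 1 m.
Proof.
  intros Hm Hu.
  rewrite (sum_n_m_Chasles _ 1 m M) by lia.
  rewrite (sum_ext_loc _ (fun k => (INR m + u - INR k) ^ 3) 1 m).
  - rewrite (sum_ext_loc _ (fun _ => zero) (S m) M).
    + rewrite sum_n_m_const_zero. apply plus_zero_r.
    + intros k [H _]. apply le_INR in H. rewrite S_INR in H.
      apply cub_nonpos. lra.
  - intros k [_ H]. apply le_INR in H. apply cub_nonneg. lra.
Qed.

Lemma has_profile_corrected_rule : has_profile Q n s (end_profile l s).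
Proof.
  assert (HN := adm_N). assert (Hs := adm_s).
  assert (HM : (1 <= M)%nat).
  { destruct adm as (_ & E & _). fold N in E. apply INR_le; simpl; lra. }
  constructor.
  - apply is_quadrature_corrected_rule.
  - apply exact_corrected_rule.
  - apply peano_symmetric.
  - fold N. intros x Hx Hx2. rewrite peano_scaled by auto. unfold end_profile.
    f_equal. f_equal.
    rewrite sum_Sn_m by lia.
    rewrite (sum_ext_loc _ (fun _ => zero) 2 M).
    + rewrite sum_n_m_const_zero. rewrite plus_zero_r. reflexivity.
    + intros k [H _]. apply le_INR in H. simpl in H. apply cub_nonpos. lra.
  - fold N. intros m u Hm Hu Hx.
    assert (Hm' := Hm). apply le_INR in Hm'. simpl in Hm'.
    assert (HmM : (m <= M)%nat).
    { destruct adm as (_ & E & _). fold N in E. apply INR_le. lra. }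
    rewrite peano_scaled by lra.
    rewrite (sum_ext _ (fun k => cub (INR m + u - INR k))).
    2: { intros k; f_equal; ring. }
    rewrite sum_cub_cut by auto.
    rewrite sum_cubes.
    destruct adm as (_ & _ & _ & Hl & Hcell).
    rewrite (wsum_Forall_ext (fun y => 0 <= y <= 1 - s) l
      (fun y => cub (INR m + u - s - y)) (fun y => (INR m + u - s - y) ^ 3)); auto.
    2: { intros y Hy. apply cub_nonneg. lra. }
    rewrite Hcell. replace (INR m + u - s + s) with (INR m + u) by ring.
    replace (INR m + u - INR m) with u by ring. ring.
Qed.

End CorrectedRule.

(** * The kernel of the combined formula *)

Lemma is_quadrature_Qhat d Q' Q'' :
  is_quadrature Q' -> is_quadrature Q'' -> is_quadrature (Qhat d Q' Q'').
Proof.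
  intros H1 H2.
  destruct (is_quadrature_lincomb (d + 1) (- d) _ _ H1 H2) as (s & S1 & S2 & S3).
  exists s; repeat split; auto. intros f; rewrite <- S3. unfold Qhat; ring.
Qed.

Lemma exact_Qhat d Q' Q'' :
  exact_on_cubics Q' -> exact_on_cubics Q'' -> exact_on_cubics (Qhat d Q' Q'').
Proof. intros H1 H2 a b c e. unfold Qhat. rewrite H1, H2. ring. Qed.

Lemma peano_Qhat d Q' Q'' t :
  peano (Qhat d Q' Q'') t = (d + 1) * peano Q' t - d * peano Q'' t.
Proof. unfold peano, Qhat. field. Qed.

Lemma cell_nonneg u : 0 <= cell u.
Proof. unfold cell. apply Rmult_le_pos; apply pow2_ge_0. Qed.

Lemma ex_cell s x : 0 <= s -> 1 <= x ->
  exists m u, (1 <= m)%nat /\ 0 <= u <= 1 /\ x = INR m + u - s.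
Proof.
  intros Hs Hx. destruct (nfloor_ex (x + s)) as (m & H1 & H2); [lra|].
  exists m, (x + s - INR m). repeat split; try lra.
  destruct m; [simpl in *; lra|lia].
Qed.

(** A property of the normalised kernel needs checking only for x = n t <= n/2. *)
Lemma half_range_suffices Q (N : R) (P : R -> Prop) :
  0 < N ->
  (forall t, peano Q (1 - t) = peano Q t) ->
  (forall x, 0 <= x <= N / 2 -> P (24 * N ^ 4 * peano Q (x / N))) ->
  forall t, I01 t -> P (24 * N ^ 4 * peano Q t).
Proof.
  intros HN Hsym HP t Ht. unfold I01 in Ht.
  destruct (Rle_dec t (1 / 2)) as [H|H].
  - replace t with (t * N / N) by (field; lra). apply HP. split; [|nra].
    apply Rmult_le_pos; lra.
  - rewrite <- Hsym.
    replace (1 - t) with ((1 - t) * N / N) by (field; lra). apply HP. split; [|nra].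
    apply Rmult_le_pos; lra.
Qed.

Lemma positive_definite_of_profile Q n s k :
  (2 <= n)%nat -> 0 <= s <= 1 -> has_profile Q n s k ->
  (forall x, 0 <= x <= 1 -> 0 <= k x) -> 0 < k (1 / 3) ->
  positive_definite 4 Q.
Proof.
  intros Hn Hs [HQ Hex Hsym Hend Hcell] Hk Hk3.
  assert (HN : 2 <= INR n) by (apply le_INR in Hn; exact Hn).
  assert (HN4 : 0 < 24 * INR n ^ 4) by (apply Rmult_lt_0_compat; [lra|apply pow_lt; lra]).
  destruct (definite_of_signed_peano Q 1 (1 / 3 / INR n)) as (c & Hc & Hdef); auto.
  - intros t Ht. rewrite Rmult_1_l. apply Rmult_le_reg_l with (24 * INR n ^ 4); auto.
    rewrite Rmult_0_r.
    apply (half_range_suffices Q (INR n) (fun v => 0 <= v)); auto; [lra|].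
    intros x Hx. destruct (Rle_dec x 1) as [H|H].
    + rewrite Hend by lra. apply Hk; lra.
    + destruct (ex_cell s x) as (m & u & Hm & Hu & E); [lra..|].
      rewrite E in *. rewrite Hcell by lra || auto. apply cell_nonneg.
  - split; [apply Rdiv_lt_0_compat; lra|].
    apply Rmult_lt_reg_r with (INR n); [lra|]. unfold Rdiv at 1.
    rewrite Rmult_assoc, Rinv_l by lra. lra.
  - rewrite Rmult_1_l. apply Rmult_lt_reg_l with (24 * INR n ^ 4); auto.
    rewrite Hend by lra. lra.
  - split; auto. exists c; split; auto. lra.
Qed.

(** Nonpositivity of the kernel of the combined formula on the part x = n t <= 1;
    the factor 16 is 2^4, since the kernel [k'] belongs to the scale 1/(2n). *)
Definition scaled_ineq (k' k'' : R -> R) (d : R) : Prop :=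
  forall x, 0 <= x <= 1 -> (d + 1) * k' (2 * x) <= 16 * d * k'' x.

(** Dividing by 4 u^2 leaves (d+1)(1-2u)^2 <= 4d (1-u)^2, worst at u = 0. *)
Lemma cell_refine d u : 1 / 3 <= d -> 0 <= u <= 1 / 2 ->
  (d + 1) * cell (2 * u) <= 16 * d * cell u.
Proof.
  intros Hd Hu. unfold cell.
  assert (H : 0 <= 4 * d * (1 - u) ^ 2 - (d + 1) * (1 - 2 * u) ^ 2).
  { replace (4 * d * (1 - u) ^ 2 - (d + 1) * (1 - 2 * u) ^ 2) with
      ((3 * d - 1) * (1 - u) ^ 2 + (d + 1) * (u * (2 - 3 * u))) by ring.
    apply Rplus_le_le_0_compat; apply Rmult_le_pos; try lra.
    - apply pow2_ge_0.
    - apply Rmult_le_pos; lra. }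
  assert (H2 := Rmult_le_pos _ _ (pow2_ge_0 u) H). lra.
Qed.

Section Pair.

Variables (Q' Q'' : functional) (n : nat) (s : R) (k' k'' : R -> R).
Hypothesis Hn : (2 <= n)%nat.
Hypothesis Hs : s = 0 \/ s = 1 / 2.
Hypothesis P' : has_profile Q' (2 * n) 0 k'.
Hypothesis P'' : has_profile Q'' n s k''.

Let N := INR n.

Lemma pair_N : 2 <= N.
Proof. apply le_INR in Hn. exact Hn. Qed.

Lemma peano_Qhat_end d x : 0 <= x <= 1 ->
  24 * N ^ 4 * peano (Qhat d Q' Q'') (x / N) =
  ((d + 1) * k' (2 * x) - 16 * d * k'' x) / 16.
Proof.
  intros Hx. assert (HN := pair_N). rewrite peano_Qhat.
  assert (E2 : INR (2 * n) = 2 * N) by (rewrite mult_INR; reflexivity).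
  rewrite <- (profile_end _ _ _ _ P') by (rewrite ?E2; lra).
  rewrite <- (profile_end _ _ _ _ P'') by (fold N; destruct Hs; lra).
  rewrite E2. fold N. replace (2 * x / (2 * N)) with (x / N) by (field; lra).
  field.
Qed.

(** A cell of the formula at scale 1/n is the union of two cells of the formula at
    scale 1/(2n), because the shift 2s is an integer. *)
Lemma peano_Qhat_interior_nonpos d x : 1 / 3 <= d -> 1 <= x <= N / 2 ->
  24 * N ^ 4 * peano (Qhat d Q' Q'') (x / N) <= 0.
Proof.
  intros Hd Hx. assert (HN := pair_N). rewrite peano_Qhat.
  assert (E2 : INR (2 * n) = 2 * N) by (rewrite mult_INR; reflexivity).
  destruct (ex_cell s x) as (m & u & Hm & Hu & E); [destruct Hs; lra|lra|].
  assert (C'' := profile_cell _ _ _ _ P'' m u Hm Hu). rewrite <- E in C''.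
  specialize (C'' (proj2 Hx)). fold N in C''.
  assert (E' : exists m', (1 <= m')%nat /\ INR m' = 2 * INR m - 2 * s).
  { destruct Hs as [H|H]; [exists (2 * m)%nat|exists (2 * m - 1)%nat];
      split; try lia; rewrite ?minus_INR, mult_INR by lia; simpl; lra. }
  destruct E' as (m' & Hm' & E').
  assert (C' : exists v, 24 * (2 * N) ^ 4 * peano Q' (2 * x / (2 * N)) = cell v /\
    (d + 1) * cell v <= 16 * d * cell u).
  { rewrite <- E2. destruct (Rle_dec u (1 / 2)) as [H|H].
    - exists (2 * u). split; [|apply cell_refine; lra].
      replace (2 * x) with (INR m' + 2 * u - 0) by (rewrite E', E; ring).
      apply (profile_cell _ _ _ _ P'); auto; [lra|]. rewrite E', E2. lra.
    - exists (2 * u - 1). split.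
      + replace (2 * x) with (INR (S m') + (2 * u - 1) - 0)
          by (rewrite S_INR, E', E; ring).
        apply (profile_cell _ _ _ _ P'); [lia|lra|]. rewrite S_INR, E', E2. lra.
      + rewrite <- (cell_compl u), <- (cell_compl (2 * u - 1)).
        replace (1 - (2 * u - 1)) with (2 * (1 - u)) by ring.
        apply cell_refine; lra. }
  destruct C' as (v & Cv & I).
  replace (2 * x / (2 * N)) with (x / N) in Cv by (field; lra).
  rewrite <- Cv, <- C'' in I.
  replace ((d + 1) * (24 * (2 * N) ^ 4 * peano Q' (x / N))) with
    (16 * (24 * N ^ 4 * ((d + 1) * peano Q' (x / N)))) in I by ring.
  lra.
Qed.

(** The strict inequality at 3/4 only serves to exclude a vanishing kernel. *)
Lemma negative_definite_Qhat d :
  1 / 3 <= d -> scaled_ineq k' k'' d ->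
  (d + 1) * k' (2 * (3 / 4)) < 16 * d * k'' (3 / 4) ->
  negative_definite 4 (Qhat d Q' Q'').
Proof.
  intros Hd Hineq Hstrict. assert (HN := pair_N).
  assert (HN4 : 0 < 24 * N ^ 4) by (apply Rmult_lt_0_compat; [lra|apply pow_lt; lra]).
  assert (HQ : is_quadrature (Qhat d Q' Q'')).
  { apply is_quadrature_Qhat; [apply P'|apply P'']. }
  assert (Hsym : forall t, peano (Qhat d Q' Q'') (1 - t) = peano (Qhat d Q' Q'') t).
  { intros t. rewrite !peano_Qhat, (profile_symmetric _ _ _ _ P'),
      (profile_symmetric _ _ _ _ P''). reflexivity. }
  destruct (definite_of_signed_peano (Qhat d Q' Q'') (-1) (3 / 4 / N))
    as (c & Hc & Hdef); auto.
  - apply exact_Qhat; [apply P'|apply P''].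
  - intros t Ht.
    assert (H : 24 * N ^ 4 * peano (Qhat d Q' Q'') t <= 0).
    { apply (half_range_suffices _ N (fun v => v <= 0)); auto; [lra|].
      intros x Hx. destruct (Rle_dec x 1) as [H|H].
      - rewrite peano_Qhat_end by lra. specialize (Hineq x). lra.
      - apply peano_Qhat_interior_nonpos; lra. }
    apply Rmult_le_reg_l with (24 * N ^ 4); auto. lra.
  - split; [apply Rdiv_lt_0_compat; lra|].
    apply Rmult_lt_reg_r with N; [lra|]. unfold Rdiv at 1.
    rewrite Rmult_assoc, Rinv_l by lra. lra.
  - assert (H := peano_Qhat_end d (3 / 4)).
    apply Rmult_lt_reg_l with (24 * N ^ 4); auto. lra.
  - split; auto. exists c; split; auto. lra.
Qed.

Lemma scaled_ineq_of_negative_definite d :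
  negative_definite 4 (Qhat d Q' Q'') ->
  scaled_ineq k' k'' d.
Proof.
  intros Hdef x Hx. assert (HN := pair_N).
  assert (HN4 : 0 < 24 * N ^ 4) by (apply Rmult_lt_0_compat; [lra|apply pow_lt; lra]).
  assert (H : peano (Qhat d Q' Q'') (x / N) <= 0).
  { apply peano_nonpos_of_negative_definite; auto.
    - apply exact_Qhat; [apply P'|apply P''].
    - split; [apply Rmult_le_pos; [lra|left; apply Rinv_0_lt_compat; lra]|].
      apply Rmult_lt_reg_r with N; [lra|]. unfold Rdiv at 1.
      rewrite Rmult_assoc, Rinv_l by lra. lra. }
  assert (H2 := peano_Qhat_end d x).
  assert (H3 : 24 * N ^ 4 * peano (Qhat d Q' Q'') (x / N) <= 24 * N ^ 4 * 0).
  { apply Rmult_le_compat_l; lra. }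
  lra.
Qed.

End Pair.

(** * The smallest factor *)

(** All members of the family [F] have the same profile [k], and it makes them
    positive definite.  The value at 1/3 excludes a vanishing kernel. *)
Definition family_profile (F : formula_family) (s : R) (k : R -> R) : Prop :=
  (2 <= min_index F)%nat /\ (s = 0 \/ s = 1 / 2) /\
  (forall n, (min_index F <= n)%nat -> has_profile (form F n) n s k) /\
  0 < k (1 / 3) /\ forall x, 0 <= x <= 1 -> 0 <= k x.

Lemma triple_of_scaled_ineq F' F'' s k' k'' c :
  family_profile F' 0 k' -> family_profile F'' s k'' ->
  1 / 3 <= c -> scaled_ineq k' k'' c ->
  (c + 1) * k' (2 * (3 / 4)) < 16 * c * k'' (3 / 4) ->
  (forall d, 0 < d -> scaled_ineq k' k'' d -> c <= d) ->
  triple_property F' F'' c.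
Proof.
  intros (M' & _ & H' & T' & P') (M'' & Hs & H'' & T'' & P'')
    Hc Hineq Hstrict Hmin n Hn Hn' Hn''.
  assert (A' := H' _ Hn'). assert (A'' := H'' _ Hn'').
  assert (Hn2 : (2 <= n)%nat) by lia.
  assert (Hn4 : (2 <= 2 * n)%nat) by lia.
  assert (Hs0 : 0 <= s <= 1) by (destruct Hs; lra).
  split; [|split; [|split; [|split]]].
  - apply (positive_definite_of_profile _ _ 0 k' Hn4 ltac:(lra) A'); auto.
  - apply (positive_definite_of_profile _ _ s k'' Hn2 Hs0 A''); auto.
  - lra.
  - apply (negative_definite_Qhat _ _ n s k' k'' Hn2 Hs A' A''); auto.
  - intros d Hd Hdef. apply Hmin; auto.
    apply (scaled_ineq_of_negative_definite _ _ n s k' k'' Hn2 Hs A' A'' d Hdef).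
Qed.

(** The condition on [d] reads k'(2x) <= d (16 k''(x) - k'(2x)) for all [x], so the
    admissible [d] > 0 form a closed half-line; its end point is found as the least
    upper bound of the lower bounds.  The point [x0] shows that [lo] is a lower
    bound. *)
Lemma ex_smallest_factor k' k'' lo hi x0 :
  (forall x, 0 <= x <= 1 -> 0 <= k' (2 * x)) ->
  0 < lo < hi -> scaled_ineq k' k'' hi ->
  0 <= x0 <= 1 -> 0 < 16 * k'' x0 - k' (2 * x0) ->
  lo * (16 * k'' x0 - k' (2 * x0)) <= k' (2 * x0) ->
  exists c, lo <= c <= hi /\ scaled_ineq k' k'' c /\
    forall d, 0 < d -> scaled_ineq k' k'' d -> c <= d.
Proof.
  intros Hk Hlo Hhi Hx0 Hp0 Hlo0.
  set (L := fun e => forall d, 0 < d -> scaled_ineq k' k'' d -> e <= d).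
  assert (Llo : L lo).
  { intros d Hd Id. specialize (Id x0 Hx0).
    apply Rmult_le_reg_r with (16 * k'' x0 - k' (2 * x0)); auto. lra. }
  assert (Lhi : forall e, L e -> e <= hi) by (intros e He; apply He; [lra|auto]).
  destruct (completeness L) as (c & Hub & Hlub).
  - exists hi. exact Lhi.
  - exists lo; auto.
  - exists c. assert (Hc : lo <= c) by (apply Hub; auto).
    repeat split; auto.
    + intros x Hx. destruct (Rle_lt_dec ((c + 1) * k' (2 * x)) (16 * c * k'' x)) as [|H];
        auto. exfalso.
      specialize (Hhi x Hx). specialize (Hk x Hx).
      set (a := 16 * k'' x - k' (2 * x)).
      assert (Ha : 0 < a).
      { destruct (Rle_lt_dec a 0) as [Ha|]; auto. exfalso.
        unfold a in Ha. nra. }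
      (* a violation at [x] makes k'(2x)/a a lower bound larger than [c] *)
      assert (Lq : L (k' (2 * x) / a)).
      { intros d Hd Id. specialize (Id x Hx).
        apply Rmult_le_reg_r with a; auto. unfold Rdiv.
        rewrite Rmult_assoc, Rinv_l by lra. unfold a in *; lra. }
      apply Hub in Lq. apply (Rmult_le_compat_r a) in Lq; [|lra].
      unfold Rdiv in Lq. rewrite Rmult_assoc, Rinv_l in Lq by lra.
      unfold a in Lq. lra.
    + intros d Hd Id. apply Hlub. intros e He. apply He; auto.
Qed.

(** To be applied with [lo] and [hi] on either side of the smallest factor, and with
    [x0] close to a maximum point of the ratio k'(2x)/k''(x). *)
Lemma triple_decimal_of_scaled_ineq F' F'' s k' k'' dec lo hi x0 :
  family_profile F' 0 k' -> family_profile F'' s k'' ->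
  (forall x, 0 <= x <= 1 -> 0 <= k' (2 * x)) ->
  1 / 3 <= lo < hi -> dec - 1 / 10 ^ 6 < lo -> hi < dec + 1 / 10 ^ 6 ->
  scaled_ineq k' k'' hi ->
  0 <= x0 <= 1 -> 0 < 16 * k'' x0 - k' (2 * x0) ->
  lo * (16 * k'' x0 - k' (2 * x0)) <= k' (2 * x0) ->
  (1 / 3 + 1) * k' (2 * (3 / 4)) < 16 * (1 / 3) * k'' (3 / 4) ->
  triple_property_decimal F' F'' dec.
Proof.
  intros H' H'' Hk Hlo Hl Hh Hhi Hx0 Hp0 Hlo0 Hstrict.
  destruct (ex_smallest_factor k' k'' lo hi x0) as (c & Hc & Ic & Hmin); auto; [lra|].
  exists c. split; [apply Rabs_def1; lra|].
  eapply triple_of_scaled_ineq; eauto; [lra|].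
  assert (P : 0 <= k' (2 * (3 / 4))) by (apply Hk; lra). nra.
Qed.

(** * The four families *)

(** End corrections of the families, in units of 1/n.  In [l332] and [l342] the
    weight at the first node of the compound sum is reduced by the unit weight that
    [corrected_rule] already puts there. *)
Definition l331 : list (R * R) :=
  (0, - (5 / 12)) :: (1 / 6, 3 / 2) :: (1 / 3, - (3 / 4)) :: (1 / 2, 1 / 6) :: nil.
Definition l332 : list (R * R) :=
  (0, - (1 / 12)) :: (1 / 4, 8 / 9) :: (1 / 2, - (1 / 3)) :: (1, 1 / 36) :: nil.
Definition l333 : list (R * R) :=
  (0, - (1 / 9)) :: (1 / 4, 1) :: (1 / 2, - (1 / 2)) :: (3 / 4, 1 / 9) :: nil.
Definition l342 : list (R * R) :=
  (0, - (5 / 48)) :: (1 / 6, 15 / 16) :: (1 / 3, - (21 / 16)) :: (1 / 2, 23 / 48) :: nil.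

Ltac admissible_tac :=
  split; [assumption|split; [|split; [auto|split]]];
  [rewrite ?minus_INR by lia; simpl; lra
  |repeat constructor; simpl; lra
  |intros z; unfold wsum, cell; simpl; field].

Lemma admissible331 n : (2 <= n)%nat -> admissible l331 0 (n - 1) n.
Proof. intros Hn. admissible_tac. Qed.
Lemma admissible332 n : (2 <= n)%nat -> admissible l332 0 (n - 1) n.
Proof. intros Hn. admissible_tac. Qed.
Lemma admissible333 n : (2 <= n)%nat -> admissible l333 0 (n - 1) n.
Proof. intros Hn. admissible_tac. Qed.
Lemma admissible342 n : (2 <= n)%nat -> admissible l342 (1 / 2) n n.
Proof. intros Hn. admissible_tac. Qed.

Lemma form331 n : (2 <= n)%nat -> form Q331 n = corrected_rule l331 0 (n - 1) n.
Proof.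
  intros Hn. assert (HN : INR n <> 0) by (apply not_0_INR; lia).
  apply functional_extensionality; intros f.
  unfold corrected_rule, wsum; simpl.
  rewrite (sum_ext (fun k => f ((INR k - 0) / INR n)) (fun k => f (INR k / INR n)))
    by (intros; rewrite Rminus_0_r; reflexivity).
  replace (0 / INR n) with 0 by (field; auto).
  replace (1 / 6 / INR n) with (1 / (6 * INR n)) by (field; auto).
  replace (1 / 3 / INR n) with (1 / (3 * INR n)) by (field; auto).
  replace (1 / 2 / INR n) with (1 / (2 * INR n)) by (field; auto).
  field; auto.
Qed.

Lemma form333 n : (2 <= n)%nat -> form Q333 n = corrected_rule l333 0 (n - 1) n.
Proof.
  intros Hn. assert (HN : INR n <> 0) by (apply not_0_INR; lia).
  apply functional_extensionality; intros f.
  unfold corrected_rule, wsum; simpl.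
  rewrite (sum_ext (fun k => f ((INR k - 0) / INR n)) (fun k => f (INR k / INR n)))
    by (intros; rewrite Rminus_0_r; reflexivity).
  replace (0 / INR n) with 0 by (field; auto).
  replace (1 / 4 / INR n) with (1 / (4 * INR n)) by (field; auto).
  replace (1 / 2 / INR n) with (1 / (2 * INR n)) by (field; auto).
  replace (3 / 4 / INR n) with (3 / (4 * INR n)) by (field; auto).
  field; auto.
Qed.

Lemma sum_ends (a : nat -> R) p q : (p < q)%nat ->
  sum_n_m a p q = a p + sum_n_m a (S p) (q - 1) + a q.
Proof.
  intros H. rewrite sum_Sn_m by lia.
  replace (sum_n_m a (S p) q) with (plus (sum_n_m a (S p) (q - 1)) (a q)).
  - unfold plus; simpl. ring.
  - destruct q as [|q]; [lia|]. rewrite (sum_n_Sm a (S p) q) by lia.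
    replace (S q - 1)%nat with q by lia. reflexivity.
Qed.

(** The nodes 1/n and 1 - 1/n complete the sum over k = 2, ..., n-2. *)
Lemma form332 n : (3 <= n)%nat -> form Q332 n = corrected_rule l332 0 (n - 1) n.
Proof.
  intros Hn. assert (HN : INR n <> 0) by (apply not_0_INR; lia).
  apply functional_extensionality; intros f.
  unfold corrected_rule, wsum. simpl form. simpl fold_right.
  rewrite (sum_ext (fun k => f ((INR k - 0) / INR n)) (fun k => f (INR k / INR n)))
    by (intros; rewrite Rminus_0_r; reflexivity).
  rewrite (sum_ends (fun k => f (INR k / INR n)) 1 (n - 1)) by lia.
  replace (n - 1 - 1)%nat with (n - 2)%nat by lia.
  rewrite minus_INR by lia. change (INR 1) with 1.
  replace (0 / INR n) with 0 by (field; auto).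
  replace (1 / 4 / INR n) with (1 / (4 * INR n)) by (field; auto).
  replace (1 / 2 / INR n) with (1 / (2 * INR n)) by (field; auto).
  replace ((INR n - 1) / INR n) with (1 - 1 / INR n) by (field; auto).
  unfold Defs.sigma. field; auto.
Qed.

(** The nodes 1/(2n) and 1 - 1/(2n) complete the sum over k = 2, ..., n-1. *)
Lemma form342 n : (3 <= n)%nat -> form Q342 n = corrected_rule l342 (1 / 2) n n.
Proof.
  intros Hn. assert (HN : INR n <> 0) by (apply not_0_INR; lia).
  apply functional_extensionality; intros f.
  unfold corrected_rule, wsum. simpl form. simpl fold_right.
  rewrite (sum_ext (fun k => f ((INR k - 1 / 2) / INR n)) (fun k => f (ynode k n)))
    by (intros; unfold ynode; f_equal; field; auto).
  rewrite (sum_ends (fun k => f (ynode k n)) 1 n) by lia.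
  replace (0 / INR n) with 0 by (field; auto).
  replace (1 / 6 / INR n) with (1 / (6 * INR n)) by (field; auto).
  replace (1 / 3 / INR n) with (1 / (3 * INR n)) by (field; auto).
  replace (1 / 2 / INR n) with (1 / (2 * INR n)) by (field; auto).
  replace (ynode 1 n) with (1 / (2 * INR n)) by (unfold ynode; simpl; field; auto).
  replace (ynode n n) with (1 - 1 / (2 * INR n)) by (unfold ynode; field; auto).
  unfold Defs.sigma. field; auto.
Qed.

(** Their normalised kernels near the end. *)
Definition k331 : R -> R := end_profile l331 0.
Definition k332 : R -> R := end_profile l332 0.
Definition k333 : R -> R := end_profile l333 0.
Definition k342 : R -> R := end_profile l342 (1 / 2).

(** * The polynomial inequalities *)

(** Replaces the profiles by polynomials, when the hypotheses decide on which side of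
    each node the argument lies. *)
Ltac eval_profile :=
  unfold k331, k332, k333, k342, end_profile, l331, l332, l333, l342, wsum;
  cbn [fold_right fst snd];
  repeat match goal with
  | |- context [cub ?e] =>
      first [rewrite (cub_nonneg e) by lra | rewrite (cub_nonpos e) by lra]
  end.

Lemma bernstein_products a b x : a <= x <= b ->
  0 <= (x - a) ^ 4 /\ 0 <= (x - a) ^ 3 * (b - x) /\
  0 <= (x - a) ^ 2 * (b - x) ^ 2 /\ 0 <= (x - a) * (b - x) ^ 3 /\ 0 <= (b - x) ^ 4.
Proof.
  intros H. repeat split; repeat apply Rmult_le_pos; try apply pow_le; lra.
Qed.

(** Proves a quartic inequality for [x] in [a,b] when the coefficients of the
    difference of its sides in the Bernstein basis of [a,b] are nonnegative. *)
Ltac bernstein a b x :=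
  assert (a <= x <= b) by lra; eval_profile;
  destruct (bernstein_products a b x) as (? & ? & ? & ? & ?); [assumption|]; lra.

(** Disposes of the part x <= b, knowing a <= x, and leaves x > b. *)
Ltac upto x a b :=
  destruct (Rle_lt_dec x b); [solve [bernstein a b x]|].

Lemma k331_nonneg x : 0 <= x <= 1 -> 0 <= k331 x.
Proof.
  intros Hx. upto x 0 (1 / 6). upto x (1 / 6) (1 / 3). upto x (1 / 3) (1 / 2).
  bernstein (1 / 2) 1 x.
Qed.

Lemma k332_nonneg x : 0 <= x <= 1 -> 0 <= k332 x.
Proof.
  intros Hx. upto x 0 (1 / 4). upto x (1 / 4) (1 / 2). bernstein (1 / 2) 1 x.
Qed.

Lemma k333_nonneg x : 0 <= x <= 1 -> 0 <= k333 x.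
Proof.
  intros Hx. upto x 0 (1 / 4). upto x (1 / 4) (1 / 2). upto x (1 / 2) (3 / 4).
  bernstein (3 / 4) 1 x.
Qed.

Lemma k342_nonneg x : 0 <= x <= 1 -> 0 <= k342 x.
Proof.
  intros Hx. upto x 0 (1 / 6). upto x (1 / 6) (1 / 3). upto x (1 / 3) (1 / 2).
  bernstein (1 / 2) 1 x.
Qed.

Lemma k_double_nonneg (k : R -> R) :
  (forall x, 0 <= x <= 1 -> 0 <= k x) ->
  (forall x, 1 <= x <= 2 -> k x = cell (x - 1)) ->
  forall x, 0 <= x <= 1 -> 0 <= k (2 * x).
Proof.
  intros H1 H2 x Hx. destruct (Rle_dec (2 * x) 1).
  - apply H1; lra.
  - rewrite H2 by lra. apply cell_nonneg.
Qed.

Lemma k331_cell x : 1 <= x <= 2 -> k331 x = cell (x - 1).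
Proof. intros Hx. eval_profile. unfold cell. field. Qed.

Lemma k332_cell x : 1 <= x <= 2 -> k332 x = cell (x - 1).
Proof. intros Hx. eval_profile. unfold cell. field. Qed.

Lemma k333_cell x : 1 <= x <= 2 -> k333 x = cell (x - 1).
Proof. intros Hx. eval_profile. unfold cell. field. Qed.

Lemma family_profile331 : family_profile Q331 0 k331.
Proof.
  split; [simpl; lia|split; [left; reflexivity|split; [|split]]].
  - intros n Hn. simpl in Hn. rewrite form331 by lia.
    apply (has_profile_corrected_rule _ _ _ _ (admissible331 n ltac:(lia))).
  - eval_profile. lra.
  - exact k331_nonneg.
Qed.

Lemma family_profile332 : family_profile Q332 0 k332.
Proof.
  split; [simpl; lia|split; [left; reflexivity|split; [|split]]].
  - intros n Hn. simpl in Hn. rewrite form332 by lia.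
    apply (has_profile_corrected_rule _ _ _ _ (admissible332 n ltac:(lia))).
  - eval_profile. lra.
  - exact k332_nonneg.
Qed.

Lemma family_profile333 : family_profile Q333 0 k333.
Proof.
  split; [simpl; lia|split; [left; reflexivity|split; [|split]]].
  - intros n Hn. simpl in Hn. rewrite form333 by lia.
    apply (has_profile_corrected_rule _ _ _ _ (admissible333 n ltac:(lia))).
  - eval_profile. lra.
  - exact k333_nonneg.
Qed.

Lemma family_profile342 : family_profile Q342 (1 / 2) k342.
Proof.
  split; [simpl; lia|split; [right; reflexivity|split; [|split]]].
  - intros n Hn. simpl in Hn. rewrite form342 by lia.
    apply (has_profile_corrected_rule _ _ _ _ (admissible342 n ltac:(lia))).
  - eval_profile. lra.
  - exact k342_nonneg.
Qed.

(** The intervals are split at the nodes of both formulae and, for the decimal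
    factors, around the point where the inequality is nearly an equality.  These
    factors exceed the rounded values of the constants by 95/10^8. *)
Lemma scaled_ineq_331_331 : scaled_ineq k331 k331 1.10493195.
Proof.
  intros x Hx. upto x 0 (1 / 12). upto x (1 / 12) (56 / 625).
  upto x (56 / 625) (1123 / 12500). upto x (1123 / 12500) (1 / 6).
  upto x (1 / 6) (1 / 4). upto x (1 / 4) (1 / 3). upto x (1 / 3) (1 / 2).
  bernstein (1 / 2) 1 x.
Qed.

Lemma scaled_ineq_332_331 : scaled_ineq k332 k331 (1 / 3).
Proof.
  intros x Hx. upto x 0 (1 / 8). upto x (1 / 8) (1 / 6). upto x (1 / 6) (1 / 4).
  upto x (1 / 4) (1 / 3). upto x (1 / 3) (1 / 2). bernstein (1 / 2) 1 x.
Qed.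

Lemma scaled_ineq_332_332 : scaled_ineq k332 k332 1.80345695.
Proof.
  intros x Hx. upto x 0 (1 / 8). upto x (1 / 8) (69 / 500).
  upto x (69 / 500) (1391 / 10000). upto x (1391 / 10000) (1393 / 10000).
  upto x (1393 / 10000) (1 / 4). upto x (1 / 4) (1 / 2). bernstein (1 / 2) 1 x.
Qed.

Lemma scaled_ineq_332_333 : scaled_ineq k332 k333 1.08827095.
Proof.
  intros x Hx. upto x 0 (1 / 8). upto x (1 / 8) (71 / 500).
  upto x (71 / 500) (7113 / 50000). upto x (7113 / 50000) (1 / 4).
  upto x (1 / 4) (1 / 2). upto x (1 / 2) (3 / 4). bernstein (3 / 4) 1 x.
Qed.

Lemma scaled_ineq_332_342 : scaled_ineq k332 k342 1.20777395.
Proof.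
  intros x Hx. upto x 0 (1 / 8). upto x (1 / 8) (69 / 500).
  upto x (69 / 500) (1409 / 10000). upto x (1409 / 10000) (1767 / 12500).
  upto x (1767 / 12500) (283 / 2000). upto x (283 / 2000) (567 / 4000).
  upto x (567 / 4000) (1 / 6). upto x (1 / 6) (1 / 4). upto x (1 / 4) (1 / 3).
  upto x (1 / 3) (1 / 2). bernstein (1 / 2) 1 x.
Qed.

Lemma scaled_ineq_333_331 : scaled_ineq k333 k331 (1 / 3).
Proof.
  intros x Hx. upto x 0 (1 / 8). upto x (1 / 8) (1 / 6). upto x (1 / 6) (1 / 4).
  upto x (1 / 4) (1 / 3). upto x (1 / 3) (3 / 8). upto x (3 / 8) (1 / 2).
  bernstein (1 / 2) 1 x.
Qed.

Lemma scaled_ineq_333_333 : scaled_ineq k333 k333 1.60158995.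
Proof.
  intros x Hx. upto x 0 (1 / 8). upto x (1 / 8) (69 / 500).
  upto x (69 / 500) (13863 / 100000). upto x (13863 / 100000) (13889 / 100000).
  upto x (13889 / 100000) (1 / 4). upto x (1 / 4) (3 / 8).
  upto x (3 / 8) (1 / 2). upto x (1 / 2) (3 / 4). bernstein (3 / 4) 1 x.
Qed.

Lemma scaled_ineq_333_342 : scaled_ineq k333 k342 1.82825695.
Proof.
  intros x Hx. upto x 0 (1 / 8). upto x (1 / 8) (69 / 500).
  upto x (69 / 500) (13829 / 100000). upto x (13829 / 100000) (1 / 6).
  upto x (1 / 6) (1 / 4). upto x (1 / 4) (1 / 3). upto x (1 / 3) (3 / 8).
  upto x (3 / 8) (1 / 2). bernstein (1 / 2) 1 x.
Qed.

(** As x -> 1, both kernels vanish to second order and the inequality becomes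
    d + 1 <= 4 d. *)
Lemma third_le_of_scaled_ineq k' k'' d :
  (forall x, 1 <= x <= 2 -> k' x = cell (x - 1)) ->
  (forall x, 1 / 2 <= x <= 1 -> k'' x = cell x) ->
  0 < d -> scaled_ineq k' k'' d -> 1 / 3 <= d.
Proof.
  intros H' H'' Hd Hineq. destruct (Rle_lt_dec (1 / 3) d) as [|H]; auto. exfalso.
  (* the inequality at 1 - u, divided by 4 u^2, reads
     (d+1) (1-2u)^2 <= 4d (1-u)^2; this choice of [u] violates it *)
  set (u := (1 - 3 * d) / 8).
  assert (Hu : 0 < u < 1 / 8) by (unfold u; lra).
  assert (I := Hineq (1 - u) ltac:(lra)).
  rewrite H', H'' in I by lra. unfold cell in I.
  assert (J : (d + 1) * (1 - 2 * u) ^ 2 <= 4 * d * (1 - u) ^ 2).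
  { assert (U : 0 < u ^ 2) by (apply pow_lt; lra).
    apply Rmult_le_reg_l with (4 * u ^ 2); [lra|].
    replace (2 * (1 - u) - 1) with (1 - 2 * u) in I by ring.
    replace (1 - (1 - 2 * u)) with (2 * u) in I by ring.
    replace (1 - (1 - u)) with u in I by ring. lra. }
  assert (E : d = (1 - 8 * u) / 3) by (unfold u; field).
  rewrite E in J. nra.
Qed.

Lemma k331_right x : 1 / 2 <= x <= 1 -> k331 x = cell x.
Proof. intros Hx. eval_profile. unfold cell. field. Qed.

(** * The eight triples *)

Theorem theorem3 :
  triple_property_decimal Q331 Q331 1.104931 /\
  triple_property Q332 Q331 (1 / 3) /\
  triple_property_decimal Q332 Q332 1.803456 /\
  triple_property_decimal Q332 Q333 1.088270 /\
  triple_property_decimal Q332 Q342 1.207773 /\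
  triple_property Q333 Q331 (1 / 3) /\
  triple_property_decimal Q333 Q333 1.601589 /\
  triple_property_decimal Q333 Q342 1.828256.
Proof.
  split; [|split; [|split; [|split; [|split; [|split; [|split]]]]]].
  - apply (triple_decimal_of_scaled_ineq _ _ _ _ _ _ 1.10493005 1.10493195 (897 / 10000)
      family_profile331 family_profile331).
    + exact (k_double_nonneg _ k331_nonneg k331_cell).
    + lra.
    + lra.
    + lra.
    + exact scaled_ineq_331_331.
    + lra.
    + eval_profile. lra.
    + eval_profile. lra.
    + eval_profile. lra.
  - apply (triple_of_scaled_ineq _ _ _ _ _ _ family_profile332 family_profile331).
    + lra.
    + exact scaled_ineq_332_331.
    + eval_profile. lra.
    + intros d Hd. exact (third_le_of_scaled_ineq _ _ d k332_cell k331_right Hd).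
  - apply (triple_decimal_of_scaled_ineq _ _ _ _ _ _ 1.80345505 1.80345695 (87 / 625)
      family_profile332 family_profile332).
    + exact (k_double_nonneg _ k332_nonneg k332_cell).
    + lra.
    + lra.
    + lra.
    + exact scaled_ineq_332_332.
    + lra.
    + eval_profile. lra.
    + eval_profile. lra.
    + eval_profile. lra.
  - apply (triple_decimal_of_scaled_ineq _ _ _ _ _ _ 1.08826905 1.08827095 (1421 / 10000)
      family_profile332 family_profile333).
    + exact (k_double_nonneg _ k332_nonneg k332_cell).
    + lra.
    + lra.
    + lra.
    + exact scaled_ineq_332_333.
    + lra.
    + eval_profile. lra.
    + eval_profile. lra.
    + eval_profile. lra.
  - apply (triple_decimal_of_scaled_ineq _ _ _ _ _ _ 1.20777205 1.20777395 (283 / 2000)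
      family_profile332 family_profile342).
    + exact (k_double_nonneg _ k332_nonneg k332_cell).
    + lra.
    + lra.
    + lra.
    + exact scaled_ineq_332_342.
    + lra.
    + eval_profile. lra.
    + eval_profile. lra.
    + eval_profile. lra.
  - apply (triple_of_scaled_ineq _ _ _ _ _ _ family_profile333 family_profile331).
    + lra.
    + exact scaled_ineq_333_331.
    + eval_profile. lra.
    + intros d Hd. exact (third_le_of_scaled_ineq _ _ d k333_cell k331_right Hd).
  - apply (triple_decimal_of_scaled_ineq _ _ _ _ _ _ 1.60158805 1.60158995 (347 / 2500)
      family_profile333 family_profile333).
    + exact (k_double_nonneg _ k333_nonneg k333_cell).
    + lra.
    + lra.
    + lra.
    + exact scaled_ineq_333_333.
    + lra.
    + eval_profile. lra.
    + eval_profile. lra.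
    + eval_profile. lra.
  - apply (triple_decimal_of_scaled_ineq _ _ _ _ _ _ 1.82825505 1.82825695 (1381 / 10000)
      family_profile333 family_profile342).
    + exact (k_double_nonneg _ k333_nonneg k333_cell).
    + lra.
    + lra.
    + lra.
    + exact scaled_ineq_333_342.
    + lra.
    + eval_profile. lra.
    + eval_profile. lra.
    + eval_profile. lra.
Qed.
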